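(* Fix $(\theta,\beta)\in(0,1)^2$ and $\alpha>0$ such that $\alpha>\eta^{clu}_\theta(\beta)$. Consider the clustering problem (estimating $\ell$ from $X$) in the colored-noise ARW model $X=\ell\mu'+AZB$ with parameters $(\alpha,\beta,\theta)$, where $A\in\mathbb R^{n\times n}$ and $B\in\mathbb R^{p\times p}$ are non-random matrices with $\max\{\|A\|,\|A^{-1}\|\}\le L_p$ and $\max\{\|B\|,\|B^{-1}\|\}\le L_p$. Then for any clustering procedure $\hat\ell=\hat\ell(X)\in\{-1,1\}^n$, $$\liminf_{p\to\infty}\mathrm{Hamm}_p(\hat\ell,\alpha,\beta,\theta)\ \ge\ \tfrac12 .$$
   Context: Colored-noise ARW model. For each $p$ let $n=n_p=p^\theta$ (treated as an integer), $\epsilon_p=p^{-\beta}$, $\tau_p=p^{-\alpha}$. The labels $\ell_1,\dots,\ell_n$ are i.i.d. uniform on $\{-1,1\}$; the coordinates of $\mu\in\mathbb R^p$ are i.i.d., equal to $\tau_p$ with probability $\epsilon_p$ and to $0$ with probability $1-\epsilon_p$; $Z$ is an $n\times p$ matrix with i.i.d. $N(0,1)$ entries; $\ell,\mu,Z$ are independent. One observes $X=\ell\mu'+AZB\in\mathbb R^{n\times p}$. $L_p>0$ denotes a generic multi-$\log(p)$ term (it may differ at each occurrence): for any fixed $\delta>0$, $L_pp^{-\delta}\to0$ and $L_pp^{\delta}\to\infty$ as $p\to\infty$. $\|\cdot\|$ of a matrix is the spectral norm. Clustering error. $\mathrm{Hamm}_p(\hat\ell,\alpha,\beta,\theta)=n^{-1}\inf_{\pi\in\Pi}\sum_{i=1}^n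 P(\hat\ell_i\ne\pi(\ell_i))$, where $\Pi$ is the set of the two permutations of $\{-1,1\}$ and $P$ is over $(\mu,\ell,Z)$. The curve $\eta^{clu}_\theta$: $$\eta^{clu}_\theta(\beta)=\begin{cases}(1-2\beta)/2,&\beta\le(1-\theta)/2,\\ \theta/2,&(1-\theta)/2\le\beta\le1-\theta,\\ (1-\beta)/2,&\beta\ge1-\theta.\end{cases}$$ *)

(* Defs.v *)
From HB Require Import structures.
From mathcomp Require Import all_boot all_order all_fingroup all_algebra.
From mathcomp Require Import all_classical all_reals all_analysis.
Set Implicit Arguments.
Unset Strict Implicit.
Unset Printing Implicit Defensive.
Import Order.TTheory GRing.Theory Num.Theory.
Import numFieldNormedType.Exports.
Local Open Scope classical_set_scope.
Local Open Scope ring_scope.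

(* The integer version of p^theta. *)
Definition arw_n (R : realType) (theta : R) (p : nat) : nat :=
  Num.truncn (p%:R `^ theta).

Definition arw_eps (R : realType) (beta : R) (p : nat) : R := p%:R `^ (- beta).

Definition arw_tau (R : realType) (alpha : R) (p : nat) : R :=
  p%:R `^ (- alpha).

Definition eta_clu (R : realType) (theta beta : R) : R :=
  if beta <= (1 - theta) / 2 then (1 - 2 * beta) / 2
  else if beta <= 1 - theta then theta / 2
  else (1 - beta) / 2.

Definition multi_log (R : realType) (L : nat -> R) : Prop :=
  (forall p, 0 < L p) /\
  (forall delta : R, 0 < delta ->
     (fun p : nat => L p * p%:R `^ (- delta)) @ \oo --> (0 : R) /\
     (fun p : nat => L p * p%:R `^ delta) @ \oo --> +oo).

(* The norm that the library puts on matrices is the largest absolute value of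
   an entry, hence these two definitions. *)
Definition l2norm (R : realType) (n : nat) (x : 'cV[R]_n) : R :=
  Num.sqrt (\sum_(i < n) x i 0 ^+ 2).

Definition spectral_norm (R : realType) (m n : nat) (A : 'M[R]_(m, n)) : R :=
  sup [set l2norm (A *m x) | x in [set x : 'cV[R]_n | l2norm x <= 1]].

Definition mutually_independent (R : realType) (d : measure_display)
    (T : measurableType d) (P : probability T R) (I : finType)
    (X : I -> T -> R) : Prop :=
  forall (J : {set I}) (E : I -> set R),
    (forall i, i \in J -> measurable (E i)) ->
    P (\bigcap_(i in [set` J]) (X i @^-1` E i)) =
    (\prod_(i in J) P (X i @^-1` E i))%E.

(* A label is a boolean: false stands for 1 and true for -1. *)
Definition label_val (R : realType) (b : bool) : R := (-1) ^+ b.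

Definition arw_family (R : realType) (d : measure_display)
    (T : measurableType d) (P : probability T R) (n p : nat)
    (l : 'I_n -> {RV P >-> bool}) (mu : 'I_p -> {RV P >-> R})
    (Z : 'I_n -> 'I_p -> {RV P >-> R}) (k : 'I_n + 'I_p + 'I_n * 'I_p)
    (w : T) : R :=
  match k with
  | inl (inl i) => label_val R (l i w)
  | inl (inr j) => mu j w
  | inr (i, j) => Z i j w
  end.

(* Independence within each of l, mu, Z and independence of the three are
   together the mutual independence of all the coordinates. *)
Record arw_model (R : realType) (d : measure_display)
    (T : measurableType d) (P : probability T R) (n p : nat) (eps tau : R)
    (l : 'I_n -> {RV P >-> bool}) (mu : 'I_p -> {RV P >-> R})
    (Z : 'I_n -> 'I_p -> {RV P >-> R}) : Prop := ArwModel {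
  label_law : forall i b, P [set w | l i w = b] = (1 / 2)%:E;
  mu_law_tau : forall j, P [set w | mu j w = tau] = eps%:E;
  mu_law_zero : forall j, P [set w | mu j w = 0] = (1 - eps)%:E;
  noise_law : forall i j (E : set R), measurable E ->
    distribution P (Z i j) E = normal_prob 0 1 E;
  arw_indep : mutually_independent P (arw_family l mu Z)
}.

Definition arw_data (R : realType) (d : measure_display)
    (T : measurableType d) (P : probability T R) (n p : nat)
    (l : 'I_n -> {RV P >-> bool}) (mu : 'I_p -> {RV P >-> R})
    (Z : 'I_n -> 'I_p -> {RV P >-> R}) (A : 'M[R]_n) (B : 'M[R]_p)
    (w : T) : 'M[R]_(n, p) :=
  (\col_i label_val R (l i w)) *m (\row_j mu j w)
  + A *m (\matrix_(i, j) Z i j w) *m B.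

Definition mx_cylinders (R : realType) (n p : nat) : set (set 'M[R]_(n, p)) :=
  [set S | exists (i : 'I_n) (j : 'I_p) (E : set R),
     measurable E /\ S = [set M : 'M[R]_(n, p) | E (M i j)]].

Definition procedure_measurable (R : realType) (n p : nat)
    (hatl : 'M[R]_(n, p) -> 'I_n -> bool) : Prop :=
  forall (i : 'I_n) (b : bool),
    <<s @mx_cylinders R n p >> [set M | hatl M i = b].

Definition hamm (R : realType) (d : measure_display)
    (T : measurableType d) (P : probability T R) (n p : nat)
    (l : 'I_n -> {RV P >-> bool}) (X : T -> 'M[R]_(n, p))
    (hatl : 'M[R]_(n, p) -> 'I_n -> bool) : \bar R :=
  ((n%:R^-1)%:E *
   ereal_inf (range (fun s : {perm bool} =>
     \sum_(i < n) P [set w | hatl (X w) i <> s (l i w)])))%E.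

(* Main.v *)
(** Let [V = B^-1] and [a = tau A^-1 l].  After whitening, the data are
    [Y = a v_S' + Z], where [v_S] is the sum of the rows of [V] over the support
    [S] of [mu].  By the Cameron-Martin formula and Cauchy-Schwarz, the function
    [H M = P (M + Z \in E)] satisfies, for every event [E],
      [(sum_j c_j H (M + D_j))^2 <= sum_(j, k) c_j c_k exp <D_j, D_k>],
    and this inequality is all that is used about the Gaussian noise.  Two label
    vectors that differ at [i] give [a_1] and [a_0] with [|a_1 - a_0| <= 2 tau L],
    so it suffices to show that the mean of [H (a_1 v_S') - H (a_0 v_S')] over
    the random support [S] vanishes.
    If [p eps tau^2 -> 0] polynomially, the inequality is applied for each fixed [S].
    Otherwise [n tau^2] and [p eps^2 tau^2] vanish, and [a_0] is replaced by [a_1]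
    one column at a time along a uniformly random order.  The set [U] of the columns
    already replaced can be coupled so that all the increments are evaluated at the
    same pair [(S, U)]; their sum is then one linear combination, of
    square at most [4 p L^2 |a_1 - a_0|^2] by the inequality, and a factor
    [eps / (1 - eps)] comes from removing the current column from the support. *)

Require Import Defs.
From HB Require Import structures.
From mathcomp Require Import all_boot all_order all_fingroup all_algebra.
From mathcomp Require Import all_classical all_reals all_analysis.
From mathcomp Require Import measurable_realfun lra ring.
Import Order.TTheory GRing.Theory Num.Theory.
Import numFieldNormedType.Exports.
Local Open Scope classical_set_scope.
Local Open Scope ring_scope.

(** * Products of independent variables *)

Section density.
Context d1 d2 (X : measurableType d1) (Y : measurableType d2) (R : realType).
Variables (phi : X -> Y) (mphi : measurable_fun setT phi).
Variables (mu : {measure set X -> \bar R}) (nu : {measure set Y -> \bar R}).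
Variables (W : X -> R) (W0 : forall x, 0 <= W x) (mW : measurable_fun setT W).
Hypothesis W_density : forall E, measurable E ->
  (\int[mu]_x (\1_E (phi x) * W x)%:E = nu E)%E.
Local Open Scope ereal_scope.

Import HBNNSimple.

(** Simple functions reduce the identity to [W_density], and monotone convergence passes to the
    limit on both sides. A weight and a map together cover laws of variables ([W] equal to 1) and
    densities ([phi] the identity) at once. *)
Lemma ge0_integral_density (f : Y -> R) :
  measurable_fun setT f -> (forall y, 0 <= f y)%R ->
  \int[mu]_x (f (phi x) * W x)%:E = \int[nu]_y (f y)%:E.
Proof.
move=> mf f0.
have mf' : measurable_fun [set: Y] (fun y => (f y)%:E).
  exact/measurable_EFinP.
pose h := nnsfun_approx measurableT mf'.
have hphi n : measurable_fun setT (h n \o phi).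
  exact: measurableT_comp.
have cvh y : (fun n => (h n y)%:E) @ \oo --> (f y)%:E.
  by apply: (cvg_nnsfun_approx measurableT mf') => // *; rewrite lee_fin.
have ndh y m n : (m <= n)%N -> (h m y <= h n y)%R.
  by move=> mn; exact/lefP/nd_nnsfun_approx.
have -> : \int[nu]_y (f y)%:E = limn (fun n => \int[nu]_y (h n y)%:E).
  rewrite -monotone_convergence//.
  - by apply: eq_integral => y _; apply/esym/cvg_lim => //; exact: cvh.
  - by move=> n; exact/measurable_EFinP/measurable_funP.
  - by move=> n y _; rewrite lee_fin.
  - by move=> y _ m n mn; rewrite lee_fin; exact: ndh.
have -> : \int[mu]_x (f (phi x) * W x)%:E =
    limn (fun n => \int[mu]_x (h n (phi x) * W x)%:E).
  rewrite -monotone_convergence//.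
  - apply: eq_integral => x _; apply/esym/cvg_lim => //.
    under eq_fun do rewrite EFinM.
    by rewrite EFinM; apply: cvgeZr => //; exact: cvh.
  - by move=> n; apply/measurable_EFinP/measurable_funM => //; exact: (hphi n).
  - by move=> n y _; rewrite lee_fin mulr_ge0.
  - by move=> y _ m n mn; rewrite lee_fin ler_wpM2r//; exact: ndh.
apply: congr_lim; apply/funext => n.
have indE r : measurable_fun setT (fun x => \1_(h n @^-1` [set r]) (phi x) * W x)%R.
  apply: measurable_funM => //.
  by apply: (measurableT_comp (f := \1_(h n @^-1` [set r]) : Y -> R)).
transitivity (\int[mu]_x (\sum_(r \in range (h n))
    (r * (\1_(h n @^-1` [set r]) (phi x) * W x))%:E)).
  apply: eq_integral => x _; rewrite fimfunE mulrC fsumEFin//.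
  congr EFin; rewrite !fsbig_finite//= big_distrr/=.
  by apply: eq_bigr => r _; rewrite mulrC mulrA.
transitivity (\int[nu]_y (\sum_(r \in range (h n))
    (r * (\1_(h n @^-1` [set r]) y))%:E)); last first.
  by apply: eq_integral => x _; rewrite fimfunE fsumEFin.
rewrite !ge0_integral_fsum//; last 4 first.
- by move=> r; exact/measurable_EFinP/measurable_funM.
- by move=> r x _; rewrite nnfun_muleindic_ge0.
- by move=> r; exact/measurable_EFinP/measurable_funM.
- move=> r x _; rewrite mulrA EFinM mule_ge0// ?lee_fin//.
  exact: nnfun_muleindic_ge0.
apply: eq_fsbigr => r /[!inE] -[y _ <-].
under eq_integral do rewrite EFinM.
under [RHS]eq_integral do rewrite EFinM.
rewrite !ge0_integralZl//.
- by rewrite W_density// integral_indic// setIT.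
- exact/measurable_EFinP.
- by rewrite lee_fin.
- exact/measurable_EFinP.
- by move=> x _; rewrite lee_fin mulr_ge0.
- by rewrite lee_fin.
Qed.
End density.

Lemma prod_indic (R : realType) (I : finType) (U : Type) (F : I -> set U) (x : I -> U) :
  \prod_i \1_(F i) (x i) = `[< forall i, F i (x i) >]%:R :> R.
Proof.
case: asboolP => [Fx|/existsNP[i Fi]].
  by rewrite big1// => i _; rewrite indicE mem_set.
by rewrite (bigD1 i)//= indicE memNset ?mul0r.
Qed.

Section expectation_prod.
Context d (T : measurableType d) (R : realType) (P : probability T R).
Variables (I : finType) (X : I -> {RV P >-> R}).
Hypothesis indepX : mutually_independent P (fun i => X i : T -> R).

(** Independence is the case where all factors are indicators. General factors are introduced one
    index at a time: [s] lists the indices whose factor need not be an indicator. When [k] joins the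
    list, the induction hypothesis with [\1_E] at [k] says that the product [W] of the other factors
    weights the law of [X k] by the constant [c], and [ge0_integral_density] replaces [\1_E] by
    [f k]. *)
Lemma expectation_prod_independent (f : I -> R -> R) (m : I -> R) :
  (forall i, measurable_fun setT (f i)) -> (forall i x, 0 <= f i x) ->
  (forall i, \int[P]_w (f i (X i w))%:E = (m i)%:E)%E ->
  (\int[P]_w (\prod_i f i (X i w))%:E = (\prod_i m i)%:E)%E.
Proof.
suff H (s : seq I) : forall (f : I -> R -> R) (m : I -> R),
    (forall i, i \notin s -> exists2 E, measurable E & f i = \1_E) ->
    (forall i, measurable_fun setT (f i)) -> (forall i x, 0 <= f i x) ->
    (forall i, \int[P]_w (f i (X i w))%:E = (m i)%:E)%E ->
    (\int[P]_w (\prod_i f i (X i w))%:E = (\prod_i m i)%:E)%E.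
  by apply: (H (enum I)) => i; rewrite mem_enum.
elim: s => [|k s IH] {}f {}m find mf f0 fm.
  have /choice[E mE] : forall i, exists E, measurable E /\ f i = \1_E.
    by move=> i; have [E ? ?] := find i isT; exists E.
  have mEX i : measurable (X i @^-1` E i) by apply: measurable_funPTI; exact: (mE i).1.
  have PE i : P (X i @^-1` E i) = (m i)%:E.
    rewrite -fm; under eq_integral do rewrite (mE i).2.
    rewrite -[RHS]/(\int[P]_w (\1_(X i @^-1` E i) w)%:E)%E integral_indic ?setIT//.
  have /= := @indepX [set: I]%SET E (fun i _ => (mE i).1).
  rewrite (eq_bigl predT) => [|i]; last by rewrite inE.
  under [X in _ = X -> _]eq_bigr do rewrite PE.
  rewrite prodEFin => <-.
  set B := \bigcap_(i in _) _.
  have mB : measurable B by rewrite /B; apply: fin_bigcap_measurable => [|i _]; [exact: finite_finpred|exact: mEX].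
  rewrite -(setIT B) -integral_indic//; apply: eq_integral => w _; congr EFin.
  under eq_bigr do rewrite (mE _).2.
  rewrite prod_indic indicE; congr ((_ : bool)%:R).
  apply/asboolP/idP => [EX|]; first by rewrite inE => i _; exact: EX.
  by rewrite inE => wB i; apply: wB; rewrite /= inE.
have m0 i : 0 <= m i by rewrite -lee_fin -fm integral_ge0// => w _; rewrite lee_fin.
pose c := \prod_(i | i != k) m i.
have c0 : 0 <= c by exact: prodr_ge0.
pose W w := \prod_(i | i != k) f i (X i w).
have mfX i : measurable_fun setT (fun w => f i (X i w)).
  exact: (measurableT_comp (mf i)).
have mW : measurable_fun setT W.
  have -> : W = fun w => \prod_i (if i != k then f i (X i w) else 1).
    by apply/funext => w; rewrite /W big_mkcond.
  by apply: measurable_prod => i _; case: (i != k) => //; exact: mfX.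
have W0 w : 0 <= W w by exact: prodr_ge0.
pose nu := mscale (NngNum c0) (distribution P (X k)).
under eq_integral do rewrite (bigD1 k)//= -/(W _).
rewrite (@ge0_integral_density _ _ _ _ _ (X k) _ P nu W)//.
- rewrite ge0_integral_mscale//=.
  + rewrite ge0_integral_distribution.
    * rewrite (bigD1 k)//= -/c mulrC EFinM; congr (_ * _)%E; exact: fm.
    * exact/measurable_EFinP.
    * by move=> y; rewrite lee_fin.
  + exact/measurable_EFinP.
  + by move=> y _; rewrite lee_fin.
- move=> E mE.
  pose f' i := if i == k then \1_E else f i.
  pose m' i := if i == k then fine (P (X k @^-1` E)) else m i.
  have f'E i : i != k -> f' i = f i by rewrite /f' => /negbTE ->.
  have m'E i : i != k -> m' i = m i by rewrite /m' => /negbTE ->.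
  have f'k : f' k = \1_E by rewrite /f' eqxx.
  have m'k : m' k = fine (P (X k @^-1` E)) by rewrite /m' eqxx.
  transitivity (\prod_i m' i)%:E; last first.
    rewrite (bigD1 k)//= m'k mulrC EFinM fineK ?fin_num_measure//; last exact: measurable_funPTI.
    by congr (_%:E * _)%E; apply: eq_bigr => i /m'E ->.
  rewrite -(IH f' m').
  + apply: eq_integral => w _; congr EFin; rewrite (bigD1 k)//= f'k; congr (_ * _).
    by apply: eq_bigr => i /f'E ->.
  + move=> i; have [->|ik] := eqVneq i k; first by rewrite f'k; exists E.
    by move=> iks; rewrite f'E//; apply: find; rewrite inE negb_or ik.
  + by move=> i; rewrite /f'; case: ifP.
  + by move=> i x; rewrite /f'; case: ifP.
  + move=> i; have [->|ik] := eqVneq i k; last by rewrite f'E// m'E.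
    rewrite f'k m'k fineK ?fin_num_measure//; last exact: measurable_funPTI.
    rewrite -[LHS]/(\int[P]_w (\1_(X k @^-1` E) w)%:E)%E integral_indic ?setIT//.
    exact: measurable_funPTI.
Qed.
End expectation_prod.

(** * Gaussian shifts *)

Section gaussian_shift.
Context {R : realType}.
Local Notation leb := (@lebesgue_measure R).

(* The density of [N(d, 1)] with respect to [N(0, 1)]. *)
Definition tilt (d x : R) : R := expR (d * x - d ^+ 2 / 2).

Lemma tilt_ge0 d x : 0 <= tilt d x. Proof. exact: expR_ge0. Qed.

Lemma measurable_tilt d : measurable_fun setT (tilt d).
Proof.
apply: measurableT_comp => //; apply: measurable_funB => //.
Qed.

Lemma lebesgue_measure_shift (d : R) (E : set R) : measurable E ->
  pushforward leb ((fun x => d + x) : _ -> measurableTypeR R) E = leb E.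
Proof.
move=> mE; apply/esym/lebesgue_measure_unique => // [|mS _ [[a b]] _ <-].
  exact: measurable_funD.
transitivity (leb `]a - d, b - d]%classic); last first.
  by congr (leb _); apply/seteqP; split=> x /=; rewrite !in_itv/= ltrBlDl lerBrDl.
rewrite !lebesgue_measure_itv/= !lte_fin ltrD2r; case: ifPn => // _.
by rewrite -!EFinB; congr EFin; ring.
Qed.

Lemma ge0_integral_shift (d : R) (f : R -> R) :
  measurable_fun setT f -> (forall x, 0 <= f x) ->
  (\int[leb]_x (f (d + x))%:E = \int[leb]_x (f x)%:E)%E.
Proof.
move=> mf f0.
transitivity (\int[pushforward leb ((fun x => (d + x)%R) : _ -> measurableTypeR R)]_x
    (f x)%:E)%E; last first.
  apply: eq_measure_integral => [|mS A mA _]; first exact: measurable_funD.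
  exact: lebesgue_measure_shift.
rewrite ge0_integral_pushforward//=.
- exact: measurable_funD.
- exact/measurable_EFinP.
- by move=> x _; rewrite lee_fin.
Qed.

Lemma ge0_integral_normal_prob (f : R -> R) :
  measurable_fun setT f -> (forall x, 0 <= f x) ->
  (\int[normal_prob 0 1]_x (f x)%:E = \int[leb]_x (f x * normal_pdf 0 1 x)%:E)%E.
Proof.
move=> mf f0; apply/esym; apply: (@ge0_integral_density _ _ _ _ R idfun) => //.
- exact: measurable_id.
- by move=> x; exact: normal_pdf_ge0.
- exact: measurable_normal_pdf.
- move=> E mE; rewrite /normal_prob [RHS]integral_mkcond/=.
  by apply: eq_integral => x _; rewrite patchE indicE; case: ifPn => _; rewrite ?mul1r ?mul0r.
Qed.

(** Completing the square in the exponent. *)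
Lemma normal_pdf_shift d x :
  tilt d (d + x) * normal_pdf 0 1 (d + x) = normal_pdf 0 1 x :> R.
Proof.
rewrite /normal_pdf (negbTE (oner_neq0 _)) mulrCA; congr (_ * _).
rewrite /tilt /normal_fun -expRD; congr expR; rewrite !expr1n !subr0.
by field.
Qed.

(** The Cameron-Martin formula in dimension one: translating the Lebesgue integral by [d] absorbs
    the tilt into the density. *)
Lemma integral_tilt_normal (d : R) (E : set R) : measurable E ->
  (\int[normal_prob 0 1]_x (\1_E x * tilt d x)%:E =
   normal_prob 0 1 [set x | E (d + x)%R])%E.
Proof.
move=> mE; have mE1 : measurable_fun setT (\1_E : R -> R) by [].
rewrite ge0_integral_normal_prob; last 2 first.
- by apply: measurable_funM => //; exact: measurable_tilt.
- by move=> x; rewrite mulr_ge0 ?tilt_ge0.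
rewrite -(ge0_integral_shift d)//; last 2 first.
- apply: measurable_funM; last exact: measurable_normal_pdf.
  by apply: measurable_funM => //; exact: measurable_tilt.
- by move=> x; rewrite !mulr_ge0 ?tilt_ge0 ?normal_pdf_ge0.
rewrite /normal_prob [RHS]integral_mkcond/=.
apply: eq_integral => x _; rewrite -mulrA normal_pdf_shift patchE indicE.
have -> : (x \in [set x | E (d + x)]) = (d + x \in E) by apply/idP/idP; rewrite !inE.
by case: ifPn => _; rewrite ?mul1r ?mul0r.
Qed.
End gaussian_shift.

(** * Measures on the space of matrices *)

Section weighted_image.
Context d1 d2 (X : measurableType d1) (Y : measurableType d2) (R : realType).
Variables (mu : {measure set X -> \bar R}) (phi : X -> Y) (W : X -> R).
Local Open Scope ereal_scope.

(** The image under [phi] of the measure with density [W]. The proofs are arguments, so that the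
    term alone determines its measure structure. *)
Definition weighted_image (_ : measurable_fun setT phi)
    (_ : measurable_fun setT W) (_ : forall x, (0 <= W x)%R) (E : set Y) : \bar R :=
  \int[mu]_(x in phi @^-1` E) (W x)%:E.

Hypotheses (mphi : measurable_fun setT phi) (mW : measurable_fun setT W).
Hypothesis W0 : forall x, (0 <= W x)%R.
Local Notation nu := (weighted_image mphi mW W0).

Let nu0 : nu set0 = 0.
Proof. by rewrite /weighted_image preimage_set0 integral_set0. Qed.

Let nu_ge0 E : 0 <= nu E.
Proof. by apply: integral_ge0 => x _; rewrite lee_fin. Qed.

Let nu_sigma_additive : semi_sigma_additive nu.
Proof.
move=> F mF tF mUF; rewrite /weighted_image preimage_bigcup ge0_integral_bigcup//.
- apply: is_cvg_ereal_nneg_natsum_cond => n _ _.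
  by apply: integral_ge0 => x _; rewrite lee_fin.
- by move=> k; rewrite -[X in measurable X]setTI; exact: mphi.
- apply: measurable_funTS; exact/measurable_EFinP.
- by move=> x _; rewrite lee_fin.
- apply/trivIsetP => i j _ _ ij; rewrite -preimage_setI.
  by move/trivIsetP : tF => -> //; rewrite preimage_set0.
Qed.

HB.instance Definition _ := isMeasure.Build _ _ _ nu nu0 nu_ge0 nu_sigma_additive.

Lemma weighted_imageE E :
  nu E = \int[mu]_x (\1_E (phi x) * W x)%:E.
Proof.
rewrite /weighted_image integral_mkcond; apply: eq_integral => x _.
rewrite patchE indicE.
have -> : (x \in phi @^-1` E) = (phi x \in E) by apply/idP/idP; rewrite !inE.
by case: ifPn => _; rewrite ?mul1r ?mul0r.
Qed.
End weighted_image.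

Section matrix_space.
Context (R : realType) (n p : nat).
Local Notation mxT := (g_sigma_algebraType (@mx_cylinders R n p)).

Lemma measurable_coord (i : 'I_n) (j : 'I_p) :
  measurable_fun setT (fun M : mxT => (M : 'M[R]_(n, p)) i j).
Proof.
move=> _ E mE; rewrite setTI; apply: sub_sigma_algebra.
by exists i, j, E.
Qed.

Lemma measurable_mxP d (T : measurableType d) (f : T -> 'M[R]_(n, p)) :
  (forall i j, measurable_fun setT (fun w => f w i j)) ->
  measurable_fun setT (f : T -> mxT).
Proof.
move=> mf; apply: (@measurability _ _ _ mxT setT f (@mx_cylinders R n p)) => //.
move=> _ [_ [i [j [E [mE ->]]]] <-].
by rewrite setTI; have := mf i j measurableT E mE; rewrite setTI.
Qed.

(** Rectangles are stable under intersection and include the cylinders, hence generate the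
    sigma-algebra. The whole space is itself a rectangle of finite mass, so the constant sequence
    [setT] is the required exhaustion. *)
Lemma mx_measure_unique (m1 m2 : {measure set mxT -> \bar R}) :
  (forall E : 'I_n * 'I_p -> set R, (forall k, measurable (E k)) ->
    m1 [set M : 'M[R]_(n, p) | forall k, E k (M k.1 k.2)] =
    m2 [set M : 'M[R]_(n, p) | forall k, E k (M k.1 k.2)]) ->
  (m1 setT < +oo)%E ->
  forall E : set mxT, measurable E -> m1 E = m2 E.
Proof.
move=> m12 m1oo E mE.
pose G : set (set mxT) := [set S | exists E : 'I_n * 'I_p -> set R,
  (forall k, measurable (E k)) /\ S = [set M : 'M[R]_(n, p) | forall k, E k (M k.1 k.2)]].
have GT : G setT.
  by exists (fun=> setT); split => //; apply/seteqP; split.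
have cylG : @mx_cylinders R n p `<=` G.
  move=> _ [i [j [F [mF ->]]]].
  exists (fun k => if k == (i, j) then F else setT); split.
    by move=> k; case: ifP.
  apply/seteqP; split => M /=.
    by move=> FM k; case: eqP => // ->.
  by move=> /(_ (i, j)); rewrite eqxx.
apply: (g_sigma_algebra_measure_unique G _ (fun=> setT)) => //.
- move=> _ [F [mF ->]].
  rewrite [X in measurable X](_ : _ = \bigcap_(k in [set: 'I_n * 'I_p])
      ((fun M : mxT => (M : 'M[R]_(n, p)) k.1 k.2) @^-1` F k)); last first.
    by apply/seteqP; split => M /= H k; [move=> _; exact: H|exact: (H k I)].
  apply: fin_bigcap_measurable => // k _.
  by rewrite -[X in measurable X]setTI; exact: measurable_coord.
- by rewrite bigcup_const.
- move=> _ _ [F [mF ->]] [F' [mF' ->]].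
  exists (fun k => F k `&` F' k); split; first by move=> k; exact: measurableI.
  apply/seteqP; split => M /=; first by move=> [H H'] k; split.
  by move=> H; split => k; have [] := H k.
- by move=> _ [F [mF ->]]; exact: m12.
- exact: sub_smallest2r cylG _ mE.
Qed.
End matrix_space.

Section gaussian_matrix.
Context d (T : measurableType d) (R : realType) (P : probability T R) (n p : nat).
Variable Z : 'I_n -> 'I_p -> {RV P >-> R}.
Hypothesis noise_law : forall i j (E : set R), measurable E ->
  distribution P (Z i j) E = normal_prob 0 1 E.
Hypothesis noise_indep :
  mutually_independent P (fun k : 'I_n * 'I_p => Z k.1 k.2 : T -> R).
Local Notation mxT := (g_sigma_algebraType (@mx_cylinders R n p)).

Definition noise_mx (w : T) : 'M[R]_(n, p) := \matrix_(i, j) Z i j w.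

(** The likelihood ratio of the law of the noise shifted by [D] to that of the noise, evaluated at
    the noise. *)
Definition noise_tilt (D : 'M[R]_(n, p)) (w : T) : R :=
  \prod_k tilt (D k.1 k.2) (Z k.1 k.2 w).

(** The Frobenius inner product, indexed by pairs like the factors of [noise_tilt]. *)
Definition mx_dot (D D' : 'M[R]_(n, p)) : R := \sum_k D k.1 k.2 * D' k.1 k.2.

Lemma measurable_noise_mx D :
  measurable_fun setT (fun w => D + noise_mx w : mxT).
Proof.
apply: measurable_mxP => i j; under eq_fun do rewrite !mxE.
exact: measurable_funD.
Qed.

Lemma measurable_noise_tilt D : measurable_fun setT (noise_tilt D).
Proof.
apply: measurable_prod => k _.
exact: (measurableT_comp (measurable_tilt _)).
Qed.

Lemma noise_tilt_ge0 D w : 0 <= noise_tilt D w.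
Proof. by apply: prodr_ge0 => k _; exact: tilt_ge0. Qed.

Lemma integral_noise (k : 'I_n * 'I_p) (f : R -> R) :
  measurable_fun setT f -> (forall x, 0 <= f x) ->
  (\int[P]_w (f (Z k.1 k.2 w))%:E = \int[normal_prob 0 1]_x (f x)%:E)%E.
Proof.
move=> mf f0.
transitivity (\int[P]_w (f (Z k.1 k.2 w) * cst 1 w)%:E)%E.
  by apply: eq_integral => w _; rewrite mulr1.
apply: (@ge0_integral_density _ _ _ (measurableTypeR R) R (Z k.1 k.2)) => //.
  exact: (@measurable_funPT _ _ _ _ (Z k.1 k.2)).
move=> E mE; transitivity (P (Z k.1 k.2 @^-1` E)); last exact: noise_law.
have mZE : measurable (Z k.1 k.2 @^-1` E) by exact: measurable_funPTI.
rewrite -[in RHS](setIT (Z k.1 k.2 @^-1` E)) -integral_indic//.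
by apply: eq_integral => w _; rewrite mulr1.
Qed.

(** The Cameron-Martin formula for the whole matrix. Both sides are finite measures in [E]. On a
    rectangle, independence factors each of them into the same product of the numbers [m k], by the
    one-dimensional formula. *)
Lemma noise_shift_density (D : 'M[R]_(n, p)) (E : set mxT) : measurable E ->
  (P [set w | E (D + noise_mx w)%R] =
   \int[P]_w (\1_E (noise_mx w) * noise_tilt D w)%:E)%E.
Proof.
move=> mE.
have mN : measurable_fun setT (noise_mx : T -> mxT).
  have := measurable_noise_mx 0; rewrite (_ : (fun w => _) = noise_mx)//.
  by apply/funext => w; rewrite add0r.
have mD := measurable_noise_mx D.
rewrite -(weighted_imageE _ _ _ _ _ P _ _ mN (measurable_noise_tilt D) (noise_tilt_ge0 D)).
rewrite -[LHS]/(pushforward P (fun w => D + noise_mx w : mxT) E).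
apply: mx_measure_unique => //; last first.
  by rewrite /= /pushforward preimage_setT probability_setT ltry.
move=> F mF; rewrite /= weighted_imageE.
pose m k := fine (normal_prob 0 1 [set x | F k (D k.1 k.2 + x)]).
have mFD k : measurable [set x | F k (D k.1 k.2 + x)].
  rewrite -[X in measurable X]setTI.
  have : measurable_fun setT (fun x : R => D k.1 k.2 + x) by exact: measurable_funD.
  by apply.
have mE1 k : normal_prob 0 1 [set x | F k (D k.1 k.2 + x)] = (m k)%:E.
  by rewrite /m fineK//; apply: fin_num_measure; exact: mFD.
have mind k : measurable_fun setT (\1_[set x | F k (D k.1 k.2 + x)] : R -> R) by [].
transitivity (\prod_k m k)%:E; last (apply/esym; last first).
- rewrite -(expectation_prod_independent _ _ _ _ _ (fun k => Z k.1 k.2) noise_indep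
    (fun k => \1_[set x | F k (D k.1 k.2 + x)]))//; last first.
    by move=> k; rewrite integral_noise// -mE1 integral_indic ?setIT//; exact: mFD.
  pose S := [set w | forall k, F k ((D + noise_mx w) k.1 k.2)].
  have mS : measurable S.
    rewrite (_ : S = \bigcap_(k in [set: 'I_n * 'I_p])
        (Z k.1 k.2 @^-1` [set x | F k (D k.1 k.2 + x)])); last first.
      by apply/seteqP; split => w /= H k; have := H k; rewrite !mxE//; apply.
    by apply: fin_bigcap_measurable => // k _; exact: measurable_funPTI.
  rewrite -[LHS]/(P S) -(setIT S) -integral_indic//.
  apply: eq_integral => w _; congr EFin; rewrite prod_indic indicE.
  congr ((_ : bool)%:R); apply/idP/asboolP; rewrite inE /= => H k.
    by have := H k; rewrite !mxE.
  by rewrite !mxE; exact: H.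
- rewrite -(expectation_prod_independent _ _ _ _ _ (fun k => Z k.1 k.2) noise_indep
    (fun k x => \1_(F k) x * tilt (D k.1 k.2) x)).
  + apply: eq_integral => w _; congr EFin; rewrite big_split/= prod_indic indicE.
    congr (_ * _); congr ((_ : bool)%:R); apply/idP/asboolP; rewrite inE /= => H k.
      by have := H k; rewrite !mxE.
    by rewrite !mxE; exact: H.
  + move=> k; apply: measurable_funM; last exact: measurable_tilt.
    exact: measurable_indic.
  + by move=> k x; rewrite mulr_ge0 ?tilt_ge0.
  + move=> k; rewrite (integral_noise k (fun x => \1_(F k) x * tilt (D k.1 k.2) x)).
    * by rewrite integral_tilt_normal// mE1.
    * apply: measurable_funM; last exact: measurable_tilt.
      exact: measurable_indic.
    * by move=> x; rewrite mulr_ge0 ?tilt_ge0.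
Qed.
End gaussian_matrix.

(** The quadratic form is the integral of the square of the combination of the [u i] with
    coefficients [a i]. Since the integrals [q i j] are real numbers, the products are integrable
    and the sums may be exchanged with the integral. *)
Lemma gram_form_ge0 d (T : measurableType d) (R : realType)
    (mu : {measure set T -> \bar R}) (I : finType) (u : I -> T -> R)
    (q : I -> I -> R) (a : I -> R) :
  (forall i, measurable_fun setT (u i)) -> (forall i x, 0 <= u i x) ->
  (forall i j, \int[mu]_x (u i x * u j x)%:E = (q i j)%:E)%E ->
  0 <= \sum_i \sum_j a i * a j * q i j.
Proof.
move=> mu_ u0 uq.
have muu i j : measurable_fun setT (fun x => u i x * u j x) by exact: measurable_funM.
have iu i j : mu.-integrable setT (fun x => (a i * a j)%:E * (u i x * u j x)%:E)%E.
  apply: integrableZl => //; apply/integrableP; split; first exact/measurable_EFinP.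
  under eq_integral do rewrite gee0_abs ?lee_fin ?mulr_ge0//.
  by rewrite uq ltry.
rewrite -lee_fin -sumEFin; under eq_bigr do rewrite -sumEFin.
have qE i j : (a i * a j * q i j)%:E =
    (\int[mu]_x ((a i * a j)%:E * (u i x * u j x)%:E))%E.
  rewrite EFinM -uq integralZl//; apply/integrableP; split; first exact/measurable_EFinP.
  under eq_integral do rewrite gee0_abs ?lee_fin ?mulr_ge0//.
  by rewrite uq ltry.
under eq_bigr do (under eq_bigr do rewrite qE; rewrite -integral_sum//).
rewrite -integral_sum//; last by move=> i; exact: integrable_sum.
apply: integral_ge0 => x _.
rewrite (_ : (\sum_i _)%E = ((\sum_i a i * u i x) ^+ 2)%:E) ?lee_fin ?sqr_ge0//.
rewrite expr2 big_distrl/= -sumEFin; apply: eq_bigr => i _.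
rewrite big_distrr/= -sumEFin; apply: eq_bigr => j _.
by rewrite -EFinM; congr EFin; ring.
Qed.

(** * The quadratic inequality for probabilities of shifted events *)

Section shift_prob.
Context d (T : measurableType d) (R : realType) (P : probability T R) (n p : nat).
Variable Z : 'I_n -> 'I_p -> {RV P >-> R}.
Hypothesis noise_law : forall i j (E : set R), measurable E ->
  distribution P (Z i j) E = normal_prob 0 1 E.
Hypothesis noise_indep :
  mutually_independent P (fun k : 'I_n * 'I_p => Z k.1 k.2 : T -> R).
Local Notation mxT := (g_sigma_algebraType (@mx_cylinders R n p)).
Local Notation noise := (noise_mx _ _ _ _ _ _ Z).
Local Notation tiltZ := (noise_tilt _ _ _ _ _ _ Z).

Definition shift_prob (E : set mxT) (M : 'M[R]_(n, p)) : R :=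
  fine (P [set w | E (M + noise w)]).

Lemma measurable_shift_event (E : set mxT) M : measurable E ->
  measurable [set w | E (M + noise w)].
Proof.
move=> mE; rewrite -[X in measurable X]setTI.
exact: (measurable_noise_mx _ _ _ _ _ _ Z M measurableT E mE).
Qed.

(** This identity yields the exponentials of inner products: a tilt has integral 1, so the product
    of two tilts integrates to [expR (mx_dot D D')]. *)
Lemma noise_tiltM D D' w :
  tiltZ D w * tiltZ D' w = expR (mx_dot _ _ _ D D') * tiltZ (D + D') w.
Proof.
rewrite /noise_tilt /mx_dot expR_sum -!big_split/=; apply: eq_bigr => k _.
by rewrite /tilt -!expRD; congr expR; rewrite !mxE; field.
Qed.

Lemma integral_noise_tilt D : (\int[P]_w (tiltZ D w)%:E = 1)%E.
Proof.
rewrite -(@probability_setT _ _ _ P).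
have := noise_shift_density _ _ _ _ _ _ Z noise_law noise_indep D setT measurableT.
rewrite (_ : [set w | _] = setT); last exact/seteqP.
by move=> ->; apply: eq_integral => w _; rewrite indicE in_setT mul1r.
Qed.

(** Each probability is the inner product of an indicator with a tilt. The claim is the
    Cauchy-Schwarz inequality for that indicator, of norm at most 1, and the combination of the
    tilts, whose squared norm is the right-hand side. *)
Lemma shift_prob_combination (E : set mxT) (J : finType) (c : J -> R)
    (D : J -> 'M[R]_(n, p)) M : measurable E ->
  (\sum_j c j * shift_prob E (M + D j)) ^+ 2 <=
  \sum_j \sum_k c j * c k * expR (mx_dot _ _ _ (D j) (D k)).
Proof.
(* Translating the event moves the base point [M] to 0. *)
move=> mE; pose E' : set mxT := [set N | E (M + N)].
have mE' : measurable E'.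
  rewrite -[X in measurable X]setTI.
  have : measurable_fun setT (fun N : mxT => M + N : mxT).
    apply: measurable_mxP => i j; under eq_fun do rewrite mxE.
    by apply: measurable_funD => //; exact: measurable_coord.
  by apply.
have shiftE D' : shift_prob E (M + D') = shift_prob E' D'.
  by rewrite /shift_prob; congr (fine (P _)); apply/seteqP; split => w; rewrite /E'/= addrA.
under eq_bigr do rewrite shiftE.
pose A := \sum_j c j * shift_prob E' (D j); have AE : A = \sum_j c j * shift_prob E' (D j) by [].
rewrite -AE.
pose u (o : option J) w :=
  if o is Some j then tiltZ (D j) w else \1_E' (noise w).
pose q (o o' : option J) := match o, o' with
  | Some j, Some k => expR (mx_dot _ _ _ (D j) (D k))
  | Some j, None | None, Some j => shift_prob E' (D j)
  | None, None => shift_prob E' 0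
  end.
pose a (o : option J) := if o is Some j then c j else - A.
have fineP D' : (shift_prob E' D')%:E = P [set w | E' (D' + noise w)].
  by rewrite fineK// fin_num_measure//; exact: measurable_shift_event.
have noise0 : (fun w => \1_E' (noise w)) = \1_[set w | E' (0 + noise w)] :> (T -> R).
  apply/funext => w; rewrite !indicE; congr ((_ : bool)%:R).
  by apply/idP/idP; rewrite !inE/= add0r.
have u0 o w : 0 <= u o w by case: o => [j|] /=; rewrite ?noise_tilt_ge0.
have mu_ o : measurable_fun setT (u o).
  case: o => [j|]; first exact: measurable_noise_tilt.
  rewrite /u noise0; apply: measurable_indic; exact: measurable_shift_event.
have uq o o' : (\int[P]_w (u o w * u o' w)%:E = (q o o')%:E)%E.
  case: o o' => [j|] [k|] /=.
  - under eq_integral do rewrite noise_tiltM EFinM.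
    rewrite ge0_integralZl//.
    + by rewrite integral_noise_tilt mule1.
    + apply/measurable_EFinP; exact: measurable_noise_tilt.
    + by move=> w _; rewrite lee_fin noise_tilt_ge0.
  - rewrite fineP noise_shift_density//.
    by apply: eq_integral => w _; rewrite mulrC.
  - by rewrite fineP noise_shift_density.
  - rewrite fineP -[X in _ = P X]setIT -integral_indic//; last exact: measurable_shift_event.
    apply: eq_integral => w _; rewrite -[in RHS]noise0; congr EFin.
    by rewrite indicE; case: (_ \in _); rewrite ?mulr1 ?mulr0.
(* The Gram form of the [tiltZ (D j)] and of [\1_E'], with coefficients [c] and [- A]. *)
have := @gram_form_ge0 _ _ _ P _ u q a mu_ u0 uq.
have optE (f : option J -> R) : \sum_o f o = f None + \sum_j f (Some j).
  rewrite (bigD1 None)//= (reindex_omap Some id)//=; last by case.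
  by congr (_ + _); apply: eq_bigl => j; rewrite eqxx.
rewrite optE; under [X in _ + X]eq_bigr do rewrite optE.
rewrite optE/= big_split/=.
have -> : \sum_(j : J) - A * c j * shift_prob E' (D j) = - A ^+ 2.
  by rewrite expr2 -mulNr [X in _ = _ * X]AE big_distrr/=; apply: eq_bigr => j _; rewrite mulrA.
have -> : \sum_(j : J) c j * - A * shift_prob E' (D j) = - A ^+ 2.
  by rewrite expr2 -mulNr [X in _ = _ * X]AE big_distrr/=; apply: eq_bigr => j _; ring.
(* The Gram form is [A ^+ 2 * shift_prob E' 0 - 2 * A ^+ 2] plus the right-hand side. It is
   nonnegative, and the probability is at most 1. *)
have : A ^+ 2 * shift_prob E' 0 <= A ^+ 2.
  rewrite ler_piMr ?sqr_ge0// -lee_fin fineP; apply: probability_le1; exact: measurable_shift_event.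
lra.
Qed.
End shift_prob.

(** * Interpolation over subsets *)

Lemma sum_set_with (R : nmodType) (I : finType) (k : I) (f : {set I} -> R) :
  \sum_(U : {set I} | k \in U) f U = \sum_(U : {set I} | k \notin U) f (k |: U)%SET.
Proof.
rewrite (reindex_onto (fun U => k |: U)%SET (fun U => U :\ k)%SET)/=; last first.
  by move=> U kU; rewrite finset.setD1K.
apply: eq_bigl => U; rewrite finset.setU11/=.
have [kU|kU] := boolP (k \in U); last by rewrite finset.setU1K// eqxx.
by apply/negbTE/eqP => UE; move: kU; rewrite -UE finset.setD11.
Qed.

Lemma shapley_weight (N u : nat) : (u <= N)%N ->
  (u.-1`! * (N.-1 - u.-1)`! * u + (u == 0) * N`! =
   u`! * (N.-1 - u)`! * (N - u) + (u == N) * N`!)%N.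
Proof.
case: N => [|N]; first by case: u.
case: u => [_|u]; first by rewrite eqxx muln0 subn0 fact0 !mul1n mul0n addn0 factS mulnC.
rewrite ltnS leq_eqVlt => /orP[/eqP ->|uN].
  by rewrite /= subnn eqxx subnn muln0 mul1n factS fact0 !muln1 mul0n addn0 mulnC.
have -> : (u.+1 == N.+1) = false by rewrite eqSS ltn_eqF.
rewrite /= subSS !mul0n !addn0 factS.
have -> : (N - u = (N - u.+1).+1)%N by rewrite subnSK.
by rewrite factS; ring.
Qed.

(* Divided by [#|I|.+1`!], the weights are the law of a random set whose size is
   uniform on [0, #|I|] and which is uniform given its size. *)
Lemma shapley_identity (R : comPzRingType) (I : finType) (F : {set I} -> R)
    (G : I -> {set I} -> R) :
  (forall k (U : {set I}), k \notin U -> F (k |: U)%SET - F U = G k U) ->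
  (forall k (U : {set I}), k \notin U -> G k (k |: U)%SET = G k U) ->
  \sum_(U : {set I}) ((#|U|)`! * (#|I| - #|U|)`!)%:R * \sum_k G k U =
  (#|I|.+1)`!%:R * (F [set: I]%SET - F finset.set0).
Proof.
set N := #|I|; move=> FG Gk.
pose w u := (u`! * (N.-1 - u)`!)%:R : R.
have ltU (k : I) (U : {set I}) : k \notin U -> (#|U| < N)%N.
  move=> kU; rewrite ltnNge; apply: contra kU => NU.
  have /eqP -> : U == [set: I]%SET by rewrite eqEcard finset.subsetT cardsT.
  by rewrite finset.in_setT.
(* For [k] outside [U], the sets [U] and [k |: U] carry the same value of [G k]. With [u = #|U|],
   their weights add up to [(u]! * (N - u.+1)[!) * N.+1]. *)
have -> : \sum_(U : {set I}) ((#|U|)`! * (N - #|U|)`!)%:R * \sum_k G k U =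
    \sum_k \sum_(U : {set I} | k \notin U) N.+1%:R * (w #|U| * G k U).
  under eq_bigr do rewrite big_distrr/=.
  rewrite exchange_big/=; apply: eq_bigr => k _.
  rewrite (bigID (fun U : {set I} => k \in U))/= sum_set_with -big_split/=.
  apply: eq_bigr => U kU; rewrite Gk// -mulrDl mulrA; congr (_ * _).
  rewrite cardsU1 kU add1n /w -natrD -natrM; congr _%:R.
  have := ltU _ _ kU; set u := #|U|; case: (N) => // N' uN'.
  rewrite ltnS in uN'; rewrite subSS subSn// !factS /=.
  have -> : (N'.+2 = u.+1 + (N' - u).+1)%N by rewrite addSn addnS subnKC.
  by ring.
(* Summation by parts: [G k U] is written as a difference of values of [F], and the coefficient of
   each [F U] is collected. *)
have -> : \sum_k \sum_(U : {set I} | k \notin U) N.+1%:R * (w #|U| * G k U) =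
    N.+1%:R * \sum_(U : {set I}) (\sum_(k in U) w #|U|.-1 - \sum_(k | k \notin U) w #|U|) * F U.
  under eq_bigr do rewrite -big_distrr/=.
  rewrite -big_distrr/=; congr (_ * _).
  under [RHS]eq_bigr do rewrite mulrBl !big_distrl/=.
  rewrite [RHS]sumrB [X in _ = X - _](exchange_big_dep xpredT)//=.
  rewrite [X in _ = _ - X](exchange_big_dep xpredT)//= -sumrB.
  apply: eq_bigr => k _; rewrite sum_set_with -sumrB.
  by apply: eq_bigr => U kU; rewrite -FG// mulrBr cardsU1 kU.
rewrite factS natrM -mulrA; congr (_ * _).
(* By [shapley_weight] the coefficients cancel except at the full and the empty set. *)
have coefE (U : {set I}) : \sum_(k in U) w #|U|.-1 - \sum_(k | k \notin U) w #|U| =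
    N`!%:R * ((U == [set: I]%SET)%:R - (U == finset.set0)%:R).
  have -> : \sum_(k | k \notin U) w #|U| = \sum_(k in ~: U) w #|U|.
    by apply: eq_bigl => k; rewrite finset.in_setC.
  rewrite !sumr_const [#|~: U|]cardsCs finset.setCK -/N.
  rewrite eqEcard finset.subsetT cardsT -/N -finset.cards_eq0 /=.
  have uN : (#|U| <= N)%N by exact: max_card.
  have /(congr1 (fun k : nat => k%:R : R)) := shapley_weight _ _ uN.
  rewrite !natrD !natrM -[w _ *+ #|U|]mulr_natr -[w _ *+ (_ - _)]mulr_natr /w !natrM => H.
  have -> : (N <= #|U|)%N = (#|U| == N) by rewrite eqn_leq uN.
  rewrite mulrBr !(mulrC (N`!%:R : R)).
  by apply/eqP; rewrite subr_eq addrAC eq_sym subr_eq eq_sym H addrC.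
under eq_bigr do rewrite coefE -mulrA.
rewrite -big_distrr/=; congr (_ * _).
under eq_bigr do rewrite mulrBl.
rewrite sumrB (bigD1 [set: I]%SET)//= eqxx mul1r big1 ?addr0; last first.
  by move=> U /negbTE ->; rewrite mul0r.
rewrite (bigD1 finset.set0)//= eqxx mul1r big1 ?addr0// => U /negbTE ->.
by rewrite mul0r.
Qed.

(** Along a path from the empty to the full set each increment has its own base set. Averaging over
    random paths evaluates all increments at one random set [U], so a bound on their sum at a common
    [U] suffices. The second hypothesis gives meaning to the increment at [k] when [U] already
    contains [k]. *)
Lemma subset_interpolation (R : realFieldType) (I : finType) (F : {set I} -> R)
    (G : I -> {set I} -> R) (C : R) :
  (forall k (U : {set I}), k \notin U -> F (k |: U)%SET - F U = G k U) ->
  (forall k (U : {set I}), k \notin U -> G k (k |: U)%SET = G k U) ->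
  (forall U, `|\sum_k G k U| <= C) ->
  `|F [set: I]%SET - F finset.set0| <= C.
Proof.
move=> FG Gk GC; have C0 : 0 <= C by apply: le_trans (GC finset.set0).
have [I0|I0] := posnP #|I|.
  have -> : [set: I]%SET = finset.set0.
    by apply/eqP; rewrite -finset.cards_eq0 cardsT I0.
  by rewrite subrr normr0.
pose W (U : {set I}) : R := ((#|U|)`! * (#|I| - #|U|)`!)%:R.
have sumW : \sum_U W U = (#|I|.+1)`!%:R.
  (* The total weight comes from the identity itself, applied to the cardinality, whose increments
     are all 1. Cancelling [#|I|] is the reason for treating the empty type apart. *)
  have := shapley_identity R I (fun U => #|U|%:R) (fun _ _ => 1).
  rewrite sumr_const -big_distrl/= cardsT cards0 subr0 => H.
  apply: (@mulIf _ #|I|%:R); first by rewrite pnatr_eq0 -lt0n.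
  by apply: H => // k U kU; rewrite cardsU1 kU natrD addrK.
have fact0 : 0 < (#|I|.+1)`!%:R :> R by rewrite ltr0n fact_gt0.
rewrite -(ler_pM2l fact0) -[X in X * `|_|]gtr0_norm// -normrM -(shapley_identity R I F G FG Gk).
rewrite -sumW mulr_suml; apply: le_trans (ler_norm_sum _ _ _) _.
by apply: ler_sum => U _; rewrite normrM ger0_norm ?ler0n// ler_wpM2l.
Qed.

(** * Exponential and norm bounds *)

Section exp_bounds.
Variable R : realType.
Implicit Types u w : R.

(** From [1 - u <= expR (- u)] one gets [expR u <= (1 - u)^-1]. Moreover
    [(1 - u) * (1 + u + 2 * u ^+ 2)] equals [1 + u ^+ 2 * (1 - 2 * u)], which is at least 1. *)
Lemma expR_le_quadratic u : u <= 1 / 2 -> expR u <= 1 + u + 2 * u ^+ 2.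
Proof.
move=> u2; have u1 : 0 < 1 - u by lra.
have : 1 - u <= expR (- u) by exact: expR_ge1Dx.
rewrite expRN => h.
have : expR u <= (1 - u)^-1 by rewrite -[expR u]invrK lef_pV2// posrE invr_gt0 expR_gt0.
move=> /le_trans; apply; rewrite invf_ple ?posrE//; last by nra.
rewrite -[_^-1]mul1r ler_pdivrMr; nra.
Qed.

(** Here [al], [be] and [ga] stand for the squared norms and the inner product of two vectors of
    squared norm at most [A]. Then [al + be - 2 * ga] is the squared norm of their difference, and
    the hypotheses are what Cauchy-Schwarz provides. The linear term is kept exact: its sum over a
    Gram matrix is controlled by the spectral norm only if signs are preserved. *)
Lemma expR_second_difference (al be ga A w : R) :
  0 <= A -> `|ga| <= A -> `|al - ga| <= 2 * A -> `|be - ga| <= 2 * A ->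
  (al - ga) ^+ 2 <= A * (al + be - 2 * ga) ->
  (be - ga) ^+ 2 <= A * (al + be - 2 * ga) ->
  A * `|w| <= 1 / 4 ->
  expR (al * w) + expR (be * w) - 2 * expR (ga * w) <=
  (al + be - 2 * ga) * w + 10 * A * (al + be - 2 * ga) * w ^+ 2.
Proof.
set de := al + be - 2 * ga.
move=> A0 gaA alA beA al2 be2 Aw.
have [A_eq0|A_neq0] := eqVneq A 0.
  move: gaA alA beA; rewrite /de A_eq0 mulr0 !normr_le0 !subr_eq0.
  by move=> /eqP -> /eqP -> /eqP ->; rewrite !mul0r; lra.
have de0 : 0 <= de.
  have : 0 <= A * de by apply: le_trans al2; exact: sqr_ge0.
  by rewrite pmulr_rge0 // lt_def A_neq0.
pose z := ga * w; pose u := (al - ga) * w; pose v := (be - ga) * w.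
have w0 : 0 <= `|w| by [].
have zA : `|z| <= A * `|w| by rewrite normrM ler_wpM2r.
have uA : `|u| <= 1 / 2 by rewrite normrM; nra.
have vA : `|v| <= 1 / 2 by rewrite normrM; nra.
have -> : al * w = z + u by rewrite /z /u; ring.
have -> : be * w = z + v by rewrite /z /v; ring.
rewrite !expRD -/z.
have := expR_le_quadratic u (le_trans (ler_norm _) uA).
have := expR_le_quadratic v (le_trans (ler_norm _) vA).
have := expR_ge1Dx u; have := expR_ge1Dx v; have := expR_ge1Dx z.
have z2 : `|z| <= 1 / 2 by lra.
have := expR_le_quadratic z (le_trans (ler_norm _) z2).
set ez := expR z; set eu := expR u; set ev := expR v => ez2 ez1 ev1 eu1 ev2 eu2.
(* After factoring out [ez], the error is [s * (de * w)], at most [2 * (A * de * w ^+ 2)], plus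
   [ez * r], at most [8 * (A * de * w ^+ 2)]. This gives the constant 10. *)
pose s := ez - 1; pose r := eu + ev - 2 - de * w.
have uv : u + v = de * w by rewrite /u /v /de; ring.
have zn : z ^+ 2 = `|z| ^+ 2 by rewrite real_normK// num_real.
have zl := ler_norm z; have zl' := ler_norm (- z); rewrite normrN in zl'.
have sz : `|s| <= 2 * (A * `|w|).
  by rewrite ler_norml /s; apply/andP; split; nra.
have r0 : 0 <= r by rewrite /r -uv; lra.
have rA : r <= 4 * (A * de * w ^+ 2).
  have u2 : u ^+ 2 <= A * de * w ^+ 2 by rewrite exprMn ler_wpM2r ?sqr_ge0.
  have v2 : v ^+ 2 <= A * de * w ^+ 2 by rewrite exprMn ler_wpM2r ?sqr_ge0.
  by rewrite /r -uv; lra.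
have ez3 : ez <= 2 by nra.
have -> : ez * eu + ez * ev - 2 * ez = de * w + s * (de * w) + ez * r.
  by rewrite /s /r; ring.
have : s * (de * w) <= 2 * (A * de * w ^+ 2).
  apply: le_trans (ler_norm _) _; rewrite normrM (normrM de) (ger0_norm de0).
  have -> : w ^+ 2 = `|w| * `|w| by rewrite -expr2 real_normK// num_real.
  have -> : 2 * (A * de * (`|w| * `|w|)) = 2 * (A * `|w|) * (de * `|w|) by ring.
  by rewrite ler_wpM2r// mulr_ge0.
have : ez * r <= 2 * r by rewrite ler_wpM2r.
lra.
Qed.
End exp_bounds.

(** * Euclidean and spectral norms *)

Section l2.
Variable R : realType.

Definition cdot n (x y : 'cV[R]_n) : R := \sum_i x i 0 * y i 0.

Lemma cdotC n (x y : 'cV[R]_n) : cdot n x y = cdot n y x.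
Proof. by apply: eq_bigr => i _; rewrite mulrC. Qed.

Lemma cdotE n (x y : 'cV[R]_n) : cdot n x y = (x^T *m y) 0 0.
Proof. by rewrite mxE; apply: eq_bigr => i _; rewrite mxE. Qed.

Lemma cdotBl n (x y z : 'cV[R]_n) : cdot n (x - y) z = cdot n x z - cdot n y z.
Proof. by rewrite -sumrB; apply: eq_bigr => i _; rewrite !mxE mulrBl. Qed.

Lemma cdotZl n a (x z : 'cV[R]_n) : cdot n (a *: x) z = a * cdot n x z.
Proof. by rewrite /cdot mulr_sumr; apply: eq_bigr => i _; rewrite !mxE mulrA. Qed.

Lemma cdot_ge0 n (x : 'cV[R]_n) : 0 <= cdot n x x.
Proof. by apply: sumr_ge0 => i _; rewrite -expr2 sqr_ge0. Qed.

Lemma cdot_eq0 n (x : 'cV[R]_n) : cdot n x x = 0 -> x = 0.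
Proof.
move/eqP; rewrite psumr_eq0 => [/allP x0|i _]; last by rewrite -expr2 sqr_ge0.
apply/colP => i; rewrite mxE; apply/eqP.
by have := x0 i (mem_index_enum _); rewrite mulf_eq0 orbb.
Qed.

Lemma cdot_cauchy_schwarz n (x y : 'cV[R]_n) :
  cdot n x y ^+ 2 <= cdot n x x * cdot n y y.
Proof.
have [y0|y0] := eqVneq (cdot n y y) 0.
  by rewrite (cdot_eq0 _ _ y0) [cdot n x 0]big1 ?expr0n/= ?mulr_ge0 ?cdot_ge0// => i _; rewrite mxE mulr0.
have yy : 0 < cdot n y y by rewrite lt_def y0 cdot_ge0.
have := cdot_ge0 _ (cdot n y y *: x - cdot n x y *: y).
rewrite cdotBl !cdotZl ![cdot n _ (_ - _)]cdotC !cdotBl !cdotZl (cdotC _ y x).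
set a := cdot n x x; set b := cdot n x y; set c := cdot n y y => H.
have : 0 <= c * (a * c - b ^+ 2) by apply: le_trans H _; rewrite le_eqVlt; apply/orP; left; apply/eqP; ring.
by rewrite pmulr_rge0// subr_ge0.
Qed.

Lemma l2norm_sqr n (x : 'cV[R]_n) : l2norm x ^+ 2 = cdot n x x.
Proof.
rewrite sqr_sqrtr; last by apply: sumr_ge0 => i _; exact: sqr_ge0.
by apply: eq_bigr => i _; rewrite expr2.
Qed.

Lemma l2norm_ge0 n (x : 'cV[R]_n) : 0 <= l2norm x.
Proof. exact: sqrtr_ge0. Qed.

Lemma l2normZ n a (x : 'cV[R]_n) : l2norm (a *: x) = `|a| * l2norm x.
Proof.
apply/eqP; rewrite -(@eqrXn2 _ 2)// ?mulr_ge0 ?l2norm_ge0//.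
by rewrite exprMn !l2norm_sqr cdotZl cdotC cdotZl mulrA real_normK ?num_real.
Qed.

(** Boundedness is what makes the [sup] in [spectral_norm] an upper bound. The Frobenius norm is a
    bound, by Cauchy-Schwarz on each row. *)
Lemma has_ubound_spectral m n (A : 'M[R]_(m, n)) :
  has_ubound [set l2norm (A *m x) | x in [set x : 'cV[R]_n | l2norm x <= 1]].
Proof.
exists (Num.sqrt (\sum_i cdot n (row i A)^T (row i A)^T)) => _ [x /= x1 <-].
apply: ler_wsqrtr; apply: ler_sum => i _.
have -> : (A *m x) i 0 = cdot n (row i A)^T x.
  by rewrite mxE; apply: eq_bigr => j _; rewrite !mxE.
apply: le_trans (cdot_cauchy_schwarz _ _ _) _.
by rewrite ler_piMr ?cdot_ge0// -l2norm_sqr expr_le1 ?l2norm_ge0.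
Qed.

Lemma l2norm_mulmx m n (A : 'M[R]_(m, n)) (x : 'cV[R]_n) :
  l2norm (A *m x) <= spectral_norm A * l2norm x.
Proof.
have [x0|x0] := eqVneq (l2norm x) 0.
  have -> : x = 0 by apply: cdot_eq0; rewrite -l2norm_sqr x0 expr0n.
  by rewrite mulmx0 -(scale0r (0 : 'cV_m)) l2normZ normr0 mul0r -(scale0r (0 : 'cV_n)) l2normZ normr0 mul0r mulr0.
have xp : 0 < l2norm x by rewrite lt_def x0 l2norm_ge0.
rewrite -ler_pdivrMr// mulrC -[_^-1]gtr0_norm ?invr_gt0// -l2normZ scalemxAr.
apply: ub_le_sup; first exact: has_ubound_spectral.
exists ((l2norm x)^-1 *: x) => //=.
by rewrite l2normZ gtr0_norm ?invr_gt0// mulVf.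
Qed.

Lemma spectral_norm_ge0 m n (A : 'M[R]_(m, n)) : 0 <= spectral_norm A.
Proof.
apply: le_trans (l2norm_ge0 _ (A *m 0)) _; apply: ub_le_sup; first exact: has_ubound_spectral.
by exists 0 => //=; rewrite -(scale0r (0 : 'cV_n)) l2normZ normr0 mul0r.
Qed.

Lemma cdot_mulmx_le m n (A : 'M[R]_(m, n)) (L : R) (x : 'cV[R]_n) :
  spectral_norm A <= L -> cdot m (A *m x) (A *m x) <= L ^+ 2 * cdot n x x.
Proof.
move=> AL; rewrite -!l2norm_sqr -exprMn ler_sqr ?nnegrE ?mulr_ge0 ?l2norm_ge0//.
  by apply: le_trans (l2norm_mulmx _ _ _ _) _; rewrite ler_wpM2r ?l2norm_ge0.
exact: le_trans (spectral_norm_ge0 _ _ _) AL.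
Qed.

(** A matrix and its transpose have the same norm: with [y = A^T *m x], the squared norm of [y] is
    the inner product of [x] and [A *m y], hence at most [L] times the product of the norms of [x]
    and [y]. *)
Lemma cdot_trmx_le m n (A : 'M[R]_(m, n)) (L : R) (x : 'cV[R]_m) :
  spectral_norm A <= L -> cdot n (A^T *m x) (A^T *m x) <= L ^+ 2 * cdot m x x.
Proof.
move=> AL; set y := A^T *m x.
have yE : cdot n y y = cdot m x (A *m y).
  by rewrite !cdotE {1}/y trmx_mul trmxK mulmxA.
have [y0|y0] := eqVneq (cdot n y y) 0; first by rewrite y0 mulr_ge0 ?sqr_ge0 ?cdot_ge0.
have yp : 0 < cdot n y y by rewrite lt_def y0 cdot_ge0.
rewrite -(ler_pM2r yp) -expr2 {1}yE; apply: le_trans (cdot_cauchy_schwarz _ _ _) _.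
rewrite [L ^+ 2 * _]mulrC -mulrA; apply: ler_wpM2l; first exact: cdot_ge0.
exact: cdot_mulmx_le.
Qed.
End l2.

(** * Random supports *)

Section support_weight.
Variables (R : realType) (I : finType) (eps : R).

Definition support_weight (S : {set I}) : R :=
  \prod_i (if i \in S then eps else 1 - eps).

Lemma sum_support_weight : \sum_(S : {set I}) support_weight S = 1.
Proof.
rewrite -[RHS](_ : \prod_(i : I) (eps + (1 - eps)) = _).
  by rewrite bigA_distr.
by rewrite big1// => i _; rewrite addrC subrK.
Qed.

Lemma support_weight_ge0 S : 0 <= eps <= 1 -> 0 <= support_weight S.
Proof. by move=> ?; apply: prodr_ge0 => i _; case: ifP => _; lra. Qed.

Lemma support_weightU1 k (S : {set I}) : eps < 1 -> k \notin S ->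
  support_weight (k |: S)%SET = eps / (1 - eps) * support_weight S.
Proof.
move=> e1 kS; rewrite /support_weight (bigD1 k)//= [in RHS](bigD1 k)//= finset.setU11 (negbTE kS).
rewrite mulrA divfK ?subr_eq0 ?gt_eqF//; congr (_ * _).
by apply: eq_bigr => i ik; rewrite finset.in_setU1 (negbTE ik).
Qed.

Lemma sum_support_weight_with k : eps < 1 ->
  \sum_(S : {set I} | k \in S) support_weight S = eps.
Proof.
move=> e1; have := sum_support_weight; rewrite (bigID (fun S : {set I} => k \in S))/=.
rewrite sum_set_with.
have -> : \sum_(S : {set I} | k \notin S) support_weight (k |: S)%SET =
    eps / (1 - eps) * \sum_(S : {set I} | k \notin S) support_weight S.
  by rewrite big_distrr/=; apply: eq_bigr => S; exact: support_weightU1.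
set b := \sum_(S | _) _ => H.
have e0 : 1 - eps != 0 by rewrite subr_eq0 gt_eqF.
(* The last factor is the total mass 1, so [b] is [1 - eps]. *)
have bE : b = (1 - eps) * (eps / (1 - eps) * b + b) by field.
by rewrite bE H mulr1 divfK.
Qed.

Lemma sum_support_weight_card : eps < 1 ->
  \sum_(S : {set I}) support_weight S * #|S|%:R = eps * #|I|%:R.
Proof.
move=> e1; under eq_bigr do rewrite -sum1_card natr_sum big_distrr/=.
rewrite (exchange_big_dep xpredT)//=.
under eq_bigr do (under eq_bigr do rewrite mulr1; rewrite sum_support_weight_with//).
by rewrite sumr_const mulr_natr.
Qed.
End support_weight.

(** * Comparison of two label vectors under a random support *)

Section two_point.
Variables (R : realType) (n p : nat).
Local Notation dot := (mx_dot R n p).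
Local Notation cd := (cdot R _).

(** The properties of Gaussian shift probabilities used in the comparison. The index type is left
    free: [bool] compares two matrices, and ['I_p * bool] treats all columns together. *)
Definition shift_regular (H : 'M[R]_(n, p) -> R) : Prop :=
  (forall M, 0 <= H M <= 1) /\
  (forall (J : finType) (c : J -> R) (D : J -> 'M[R]_(n, p)) M,
    (\sum_j c j * H (M + D j)) ^+ 2 <=
    \sum_j \sum_k c j * c k * expR (dot (D j) (D k))).

Lemma mx_dot_outer (a a' : 'cV[R]_n) (u u' : 'cV[R]_p) :
  dot (a *m u^T) (a' *m u'^T) = cd a a' * cd u u'.
Proof.
rewrite /mx_dot -(pair_bigA _ (fun i j => (a *m u^T) i j * (a' *m u'^T) i j))/=.
rewrite /cdot big_distrl/=; apply: eq_bigr => i _.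
rewrite big_distrr/=; apply: eq_bigr => j _.
by rewrite !mxE !big_ord1 !mxE; ring.
Qed.

Variables (V : 'M[R]_p) (L : R).
Hypothesis VL : spectral_norm V <= L.

Definition indicator_col (S : {set 'I_p}) : 'cV[R]_p := \col_j (j \in S)%:R.

(** The formula extracts row [j] of [V], as a column, in the form to which [cdot_trmx_le]
    applies. *)
Definition row_col (j : 'I_p) : 'cV[R]_p := V^T *m indicator_col [set j]%SET.

Lemma indicator_colE S : indicator_col S = \sum_(j in S) indicator_col [set j]%SET.
Proof.
apply/colP => i; rewrite !mxE summxE.
under eq_bigr do rewrite mxE finset.in_set1.
have [iS|iS] := boolP (i \in S).
  rewrite (bigD1 i)//= eqxx big1 ?addr0// => j /andP[_ ji].
  by rewrite eq_sym (negbTE ji).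
rewrite big1// => j jS; case: eqP => // ij; by rewrite ij jS in iS.
Qed.

Lemma trmx_indicator_col S : V^T *m indicator_col S = \sum_(j in S) row_col j.
Proof. by rewrite indicator_colE mulmx_sumr. Qed.

Lemma cdot_indicator_col S : cd (indicator_col S) (indicator_col S) = #|S|%:R.
Proof.
rewrite -sum1_card natr_sum big_mkcond/=; apply: eq_bigr => i _.
by rewrite mxE; case: ifP; rewrite ?mulr1 ?mulr0.
Qed.

Lemma cdot_support_le S :
  cd (V^T *m indicator_col S) (V^T *m indicator_col S) <= L ^+ 2 * #|S|%:R.
Proof. by rewrite -cdot_indicator_col; exact: cdot_trmx_le. Qed.

Lemma cdot_suml (I : finType) (A : {set I}) (x : I -> 'cV[R]_p) y :
  cd (\sum_(i in A) x i) y = \sum_(i in A) cd (x i) y.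
Proof.
rewrite /cdot exchange_big/=; apply: eq_bigr => i _.
by rewrite summxE big_distrl.
Qed.

Local Notation w j k := (cd (row_col j) (row_col k)).

(** The double sum is the squared norm of the sum of the rows over [S]. *)
Lemma sum_gram_le (S : {set 'I_p}) :
  \sum_(j in S) \sum_(k in S) w j k <= L ^+ 2 * #|S|%:R.
Proof.
apply: le_trans (cdot_support_le S); rewrite trmx_indicator_col cdot_suml.
rewrite le_eqVlt; apply/orP; left; apply/eqP; apply: eq_bigr => j _.
by rewrite cdotC cdot_suml; apply: eq_bigr => k _; rewrite cdotC.
Qed.

(** The numbers [w j k] are the coordinates of [V *m row_col j], so the norm bound is used twice,
    once for [V] and once for its transpose. *)
Lemma sum_gram_sqr_le (j : 'I_p) : \sum_k w j k ^+ 2 <= L ^+ 2 * L ^+ 2.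
Proof.
have -> : \sum_k w j k ^+ 2 = cd (V *m row_col j) (V *m row_col j).
  apply: eq_bigr => k _; rewrite -expr2; congr (_ ^+ 2).
  have tr i : (indicator_col [set k]%SET)^T 0 i = (i == k)%:R.
    by rewrite !mxE finset.in_set1.
  rewrite cdotC cdotE {1}/row_col trmx_mul trmxK -mulmxA mxE.
  rewrite (bigD1 k)//= tr eqxx mul1r big1 ?addr0// => i ik.
  by rewrite tr (negbTE ik) mul0r.
apply: le_trans (cdot_mulmx_le _ _ _ _ _ _ VL) _.
apply: ler_wpM2l; first exact: sqr_ge0.
by apply: le_trans (cdot_support_le _) _; rewrite finset.cards1 mulr1.
Qed.

Lemma gram_abs_le j k : `|w j k| <= L ^+ 2.
Proof.
rewrite -ler_sqr ?nnegrE ?sqr_ge0// real_normK ?num_real// expr2.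
apply: le_trans (sum_gram_sqr_le j).
by rewrite [leRHS](bigD1 k)//= lerDl sumr_ge0// => i _; exact: sqr_ge0.
Qed.

Variables (H : 'M[R]_(n, p) -> R) (Hreg : shift_regular H).

(** With coefficients 1 and -1 the inequality bounds the square by [expR x - 1], which is at most
    [2 * x] when [x <= 1 / 2]. For larger [x] the bound exceeds 1 and is trivial. *)
Lemma shift_regular_diff M M' :
  (H M' - H M) ^+ 2 <= 2 * dot (M' - M) (M' - M).
Proof.
have [H01 HC] := Hreg; set x := dot _ _.
have := HC bool (fun b => (-1) ^+ ~~ b) (fun b => if b then M' - M else 0) M.
rewrite !big_bool/= addr0 [M + (M' - M)]addrC subrK expr1 expr0 -/x.
have dot0l N : dot 0 N = 0 by rewrite /mx_dot big1// => k _; rewrite mxE mul0r.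
have dot0r N : dot N 0 = 0 by rewrite /mx_dot big1// => k _; rewrite mxE mulr0.
rewrite !dot0l dot0r expR0 => h.
have [x2|x2] := leP x (1 / 2); last first.
  have := H01 M; have := H01 M'; nra.
have x0 : 0 <= x by apply: sumr_ge0 => k _; rewrite -expr2 sqr_ge0.
have := expR_le_quadratic _ _ x2; nra.
Qed.

Variable eps : R.
Hypothesis eps01 : 0 <= eps < 1.
Local Notation pi := (support_weight R 'I_p eps).

Definition support_mean (a : 'cV[R]_n) (S : {set 'I_p}) : 'M[R]_(n, p) :=
  a *m (V^T *m indicator_col S)^T.

Let eps01' : 0 <= eps <= 1. Proof. by move: eps01 => /andP[-> /ltW ->]. Qed.
Let eps1 : eps < 1. Proof. by case/andP: eps01. Qed.

(** For fixed [S] the squared difference is linear in [#|S|]. The inequality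
    [|q| <= c / 2 + q ^+ 2 / (2 * c)] keeps this linearity, so only the mean [eps * p] of [#|S|]
    enters. *)
Lemma sparse_bound (a1 a0 : 'cV[R]_n) (c : R) : 0 < c ->
  `|\sum_S pi S * (H (support_mean a1 S) - H (support_mean a0 S))| <=
  c / 2 + cd (a1 - a0) (a1 - a0) * L ^+ 2 * (eps * p%:R) / c.
Proof.
move=> c0; set de := cd (a1 - a0) _.
have de0 : 0 <= de by exact: cdot_ge0.
have -> : c / 2 + de * L ^+ 2 * (eps * p%:R) / c =
    \sum_S pi S * (c / 2 + de * L ^+ 2 * #|S|%:R / c).
  under eq_bigr do rewrite mulrDr.
  rewrite big_split/= -big_distrl/= sum_support_weight mul1r; congr (_ + _).
  have := sum_support_weight_card R 'I_p eps eps1; rewrite card_ord => <-.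
  by rewrite big_distrr big_distrl/=; apply: eq_bigr => S _; ring.
apply: le_trans (ler_norm_sum _ _ _) _; apply: ler_sum => S _.
rewrite normrM ger0_norm ?support_weight_ge0// ler_wpM2l ?support_weight_ge0//.
set q := _ - _; have : q ^+ 2 <= 2 * (de * (L ^+ 2 * #|S|%:R)).
  apply: le_trans (shift_regular_diff _ _) _; rewrite -mulmxBl mx_dot_outer.
  by rewrite ler_wpM2l// ler_wpM2l// cdot_support_le.
rewrite -(real_normK (num_real q)) mulrA => qx.
have : `|q| * (2 * c) <= c ^+ 2 + 2 * (de * L ^+ 2 * #|S|%:R).
  have := sqr_ge0 (c - `|q|); nra.
have -> : c / 2 + de * L ^+ 2 * #|S|%:R / c =
   (c ^+ 2 + 2 * (de * L ^+ 2 * #|S|%:R)) / (2 * c) by field; lra.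
by rewrite ler_pdivlMr ?mulr_gt0.
Qed.

(** The gain over a bound column by column is a factor of order [Num.sqrt p]: near-orthogonality of
    the rows of [V] makes the square of the whole sum grow linearly in [p]. *)
Lemma gram_combination_le (a : bool -> 'cV[R]_n) (A : R) (S : {set 'I_p}) M :
  (forall b, cd (a b) (a b) <= A) -> A * L ^+ 2 <= 1 / 4 ->
  `|\sum_(k in S) (H (M + a true *m (row_col k)^T) - H (M + a false *m (row_col k)^T))|
    <= 2 * Num.sqrt (cd (a true - a false) (a true - a false) * p%:R) * L.
Proof.
move=> aA AL; set de := cd (a true - a false) _.
have de0 : 0 <= de by exact: cdot_ge0.
have A0 : 0 <= A by apply: le_trans (aA true); exact: cdot_ge0.
have L0 : 0 <= L by apply: le_trans VL; exact: spectral_norm_ge0.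
have [_ HC] := Hreg.
(* Each column of [S] contributes its two versions with opposite signs. The Gram sum then becomes a
   sum over pairs in [S] of the quantities bounded by [expR_second_difference]. *)
have := HC ('I_p * bool)%type (fun kb => (kb.1 \in S)%:R * (-1) ^+ ~~ kb.2)
  (fun kb => a kb.2 *m (row_col kb.1)^T) M.
set lhs := _ ^+ 2; set rhs := \sum_j _.
have pairE (f : 'I_p * bool -> R) : \sum_x f x = \sum_k (f (k, true) + f (k, false)).
  have -> : \sum_x f x = \sum_k \sum_b f (k, b) by rewrite pair_bigA; apply: eq_bigr; case.
  by apply: eq_bigr => k _; rewrite big_bool.
have -> : lhs = (\sum_(k in S) (H (M + a true *m (row_col k)^T) - H (M + a false *m (row_col k)^T))) ^+ 2.
  rewrite /lhs pairE; congr (_ ^+ 2); rewrite [RHS]big_mkcond/=.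
  by apply: eq_bigr => k _; case: ifP => _ /=; ring.
set al := cd (a true) (a true); set be := cd (a false) (a false).
set ga := cd (a true) (a false).
have deE : de = al + be - 2 * ga.
  rewrite /de cdotBl ![cd _ (_ - _)]cdotC !cdotBl [cd (a false) (a true)]cdotC -/al -/be -/ga.
  by ring.
have -> : rhs = \sum_(j in S) \sum_(k in S)
    (expR (al * w j k) + expR (be * w j k) - 2 * expR (ga * w j k)).
  rewrite /rhs pairE [RHS]big_mkcond/=; apply: eq_bigr => j _.
  rewrite !pairE -big_split/=; case: ifP => _; last by rewrite big1// => k _ /=; ring.
  rewrite [RHS]big_mkcond/=; apply: eq_bigr => k _; rewrite !mx_dot_outer.
  by rewrite [cd (a false) (a true)]cdotC -/al -/be -/ga; case: ifP => _ /=; ring.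
move=> h; rewrite -ler_sqr ?nnegrE ?mulr_ge0 ?sqrtr_ge0// real_normK ?num_real//.
apply: le_trans h _.
have -> : (2 * Num.sqrt (de * p%:R) * L) ^+ 2 = 4 * (de * p%:R) * L ^+ 2.
  by rewrite !exprMn sqr_sqrtr ?mulr_ge0//; ring.
have al0 : 0 <= al <= A by rewrite cdot_ge0 aA.
have be0 : 0 <= be <= A by rewrite cdot_ge0 aA.
have gaA : `|ga| <= A.
  rewrite -ler_sqr ?nnegrE// real_normK ?num_real//.
  by apply: le_trans (cdot_cauchy_schwarz _ _ _ _) _; rewrite -/al -/be; nra.
have al2 : (al - ga) ^+ 2 <= A * de.
  rewrite -[ga]cdotC -cdotBl; apply: le_trans (cdot_cauchy_schwarz _ _ _ _) _.
  by rewrite mulrC ler_wpM2r.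
have be2 : (be - ga) ^+ 2 <= A * de.
  rewrite -sqrrN opprB -cdotBl; apply: le_trans (cdot_cauchy_schwarz _ _ _ _) _.
  by rewrite mulrC ler_wpM2r.
have alA : `|al - ga| <= 2 * A.
  by move: gaA; rewrite !ler_norml => /andP[? ?]; apply/andP; split; lra.
have beA : `|be - ga| <= 2 * A.
  by move: gaA; rewrite !ler_norml => /andP[? ?]; apply/andP; split; lra.
apply: (@le_trans _ _ (\sum_(j in S) \sum_(k in S) (de * w j k + 10 * A * de * w j k ^+ 2))).
  apply: ler_sum => j _; apply: ler_sum => k _; rewrite deE.
  apply: expR_second_difference => //; rewrite -?deE//.
  by apply: le_trans AL; rewrite ler_wpM2l// gram_abs_le.
under eq_bigr do rewrite big_split/= -!big_distrr/=.
rewrite big_split/= -!big_distrr/=.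
have S1 : #|S|%:R <= p%:R :> R by rewrite ler_nat; have := max_card (mem S); rewrite card_ord.
have h1 := sum_gram_le S.
have h2 : \sum_(j in S) \sum_(k in S) w j k ^+ 2 <= #|S|%:R * (L ^+ 2 * L ^+ 2).
  rewrite -sum1_card natr_sum big_distrl/=; apply: ler_sum => j _; rewrite mul1r.
  apply: le_trans (sum_gram_sqr_le j); rewrite big_mkcond/=.
  by apply: ler_sum => k _; case: ifP; rewrite ?sqr_ge0.
have L2 : 0 <= L ^+ 2 by exact: sqr_ge0.
apply: (@le_trans _ _ (de * (L ^+ 2 * #|S|%:R) +
    10 * A * de * (#|S|%:R * (L ^+ 2 * L ^+ 2)))).
  by apply: lerD; [rewrite ler_wpM2l|rewrite ler_wpM2l ?mulr_ge0].
(* Since [A * L ^+ 2 <= 1 / 4], the prefactor is at most 7/2, which is below the 4 of the claim. *)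
have -> : de * (L ^+ 2 * #|S|%:R) + 10 * A * de * (#|S|%:R * (L ^+ 2 * L ^+ 2)) =
    (1 + 10 * (A * L ^+ 2)) * (de * L ^+ 2 * #|S|%:R) by ring.
have -> : 4 * (de * p%:R) * L ^+ 2 = 4 * (de * L ^+ 2 * p%:R) by ring.
have AL0 : 0 <= A * L ^+ 2 by rewrite mulr_ge0.
apply: ler_pM; [lra|by rewrite !mulr_ge0|lra|].
by rewrite ler_wpM2l ?mulr_ge0.
Qed.

Lemma dense_bound (a : bool -> 'cV[R]_n) (A : R) :
  (forall b, cd (a b) (a b) <= A) -> A * L ^+ 2 <= 1 / 4 ->
  `|\sum_S pi S * (H (support_mean (a true) S) - H (support_mean (a false) S))| <=
  eps / (1 - eps) *
    (2 * Num.sqrt (cd (a true - a false) (a true - a false) * p%:R) * L).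
Proof.
move=> aA AL; set C := 2 * _ * L; set r := eps / (1 - eps).
have r0 : 0 <= r by case/andP: eps01 => e0 e1; rewrite divr_ge0// subr_ge0 ltW.
(* [U] holds the columns already switched from [a false] to [a true]. *)
pose mean (S U : {set 'I_p}) := \sum_(j in S) a (j \in U) *m (row_col j)^T.
have mean_const b S : support_mean (a b) S = \sum_(j in S) a b *m (row_col j)^T.
  by rewrite /support_mean trmx_indicator_col linear_sum mulmx_sumr.
have -> : \sum_S pi S * (H (support_mean (a true) S) - H (support_mean (a false) S)) =
    (\sum_S pi S * H (mean S [set: 'I_p]%SET)) - \sum_S pi S * H (mean S finset.set0).
  rewrite -sumrB; apply: eq_bigr => S _; rewrite -mulrBr !mean_const; congr (_ * (H _ - H _)).
    by apply: eq_bigr => j _; rewrite finset.in_setT.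
  by apply: eq_bigr => j _; rewrite finset.in_set0.
(* Adding [k] to [U] matters only for supports that contain [k]. Writing these as [k |: S] turns the
   weight into [r * pi S] and leaves the base point [mean S U], which does not depend on [k]. For
   fixed [S] and [U], the increments over all [k] outside [S] thus form one combination for
   [gram_combination_le]. *)
pose G k U := r * \sum_(S : {set 'I_p} | k \notin S) pi S *
  (H (mean S U + a true *m (row_col k)^T) - H (mean S U + a false *m (row_col k)^T)).
have mean_off k (S U : {set 'I_p}) : k \notin S -> mean S (k |: U)%SET = mean S U.
  move=> kS; apply: eq_bigr => j jS; rewrite finset.in_setU1.
  by case: eqP => // jk; rewrite -jk jS in kS.
have mean_in k (S U : {set 'I_p}) : k \notin S ->
    mean (k |: S)%SET U = mean S U + a (k \in U) *m (row_col k)^T.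
  by move=> kS; rewrite /mean big_setU1//= addrC.
apply: (@subset_interpolation _ _ (fun U => \sum_S pi S * H (mean S U)) G).
- move=> k U kU; rewrite -sumrB (bigID (fun S : {set 'I_p} => k \in S))/=.
  rewrite [X in _ + X]big1 ?addr0 => [|S kS]; last by rewrite mean_off// subrr.
  rewrite sum_set_with /G big_distrr/=; apply: eq_bigr => S kS.
  by rewrite -mulrBr support_weightU1// -/r -mulrA !mean_in// finset.setU11 (negbTE kU) mean_off.
- move=> k U kU; rewrite /G; congr (_ * _); apply: eq_bigr => S kS.
  by rewrite mean_off.
- move=> U; rewrite /G -big_distrr/= normrM (ger0_norm r0); apply: ler_wpM2l => //.
  rewrite (exchange_big_dep xpredT)//=.
  apply: (@le_trans _ _ (\sum_S pi S * C)); last first.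
    by rewrite -big_distrl/= sum_support_weight mul1r.
  apply: le_trans (ler_norm_sum _ _ _) _; apply: ler_sum => S _.
  rewrite -big_distrr/= normrM ger0_norm ?support_weight_ge0//.
  apply: ler_wpM2l; first exact: support_weight_ge0.
  apply: le_trans (gram_combination_le a A (~: S)%SET (mean S U) aA AL).
  by rewrite le_eqVlt; apply/orP; left; apply/eqP; congr `|_|; apply: eq_bigl => k; rewrite finset.in_setC.
Qed.
End two_point.

(** * The ARW model *)

Lemma mutually_independent_comp (R : realType) (d : measure_display)
    (T : measurableType d) (P : probability T R) (I K : finType)
    (X : I -> T -> R) (h : K -> I) :
  injective h -> mutually_independent P X -> mutually_independent P (X \o h).
Proof.
move=> h_inj Xind J E mE.
pose E' i : set R := if [pick k | h k == i] is Some k then E k else setT.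
have E'h k : E' (h k) = E k.
  rewrite /E'; case: pickP => [k' /eqP /h_inj -> //|/(_ k)]; by rewrite eqxx.
have mE' i : i \in (h @: J)%SET -> measurable (E' i).
  by move=> /imsetP[k kJ ->]; rewrite E'h; exact: mE.
have := Xind (h @: J)%SET E' mE'; rewrite big_imset/=; last by move=> x y _ _; exact: h_inj.
under eq_bigr do rewrite E'h.
move=> <-; congr (P _); apply/seteqP; split => w /= Hw.
  by move=> i /= /imsetP[k kJ ->]; rewrite /= E'h; exact: Hw.
by move=> k kJ; have := Hw (h k); rewrite /= E'h; apply; rewrite /= imset_f.
Qed.

Section model.
Variables (R : realType) (d : measure_display) (T : measurableType d).
Variables (P : probability T R) (n p : nat) (eps tau : R).
Variables (l : 'I_n -> {RV P >-> bool}) (mu : 'I_p -> {RV P >-> R}).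
Variable Z : 'I_n -> 'I_p -> {RV P >-> R}.
Hypothesis model : arw_model eps tau l mu Z.
Hypothesis eps01 : 0 <= eps <= 1.
Hypothesis tau_neq0 : tau != 0.
Local Notation mxT := (g_sigma_algebraType (@mx_cylinders R n p)).
Local Notation noise := (noise_mx _ _ _ _ _ _ Z).

Lemma noise_independent :
  mutually_independent P (fun k : 'I_n * 'I_p => Z k.1 k.2 : T -> R).
Proof.
have -> : (fun k : 'I_n * 'I_p => Z k.1 k.2 : T -> R) =
    arw_family l mu Z \o (inr : _ -> 'I_n + 'I_p + 'I_n * 'I_p).
  by apply/funext => -[i j].
by apply: mutually_independent_comp (arw_indep model) => x y [].
Qed.

Definition signal_event (la : 'I_n -> bool) (S : {set 'I_p}) : set T :=
  [set w | (forall i, l i w = la i) /\ (forall j, mu j w = tau *+ (j \in S))].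

Lemma measurable_signal_event la S : measurable (signal_event la S).
Proof.
have -> : signal_event la S = (\bigcap_(i in [set: 'I_n]) (l i @^-1` [set la i])) `&`
    (\bigcap_(j in [set: 'I_p]) (mu j @^-1` [set tau *+ (j \in S)])).
  by apply/seteqP; split => w [/= H1 H2]; split => i; [move=> _; exact: H1|
    move=> _; exact: H2|exact: (H1 i I)|exact: (H2 i I)].
apply: measurableI; apply: fin_bigcap_measurable => // i _; exact: measurable_funPTI.
Qed.

Lemma measurable_noise : measurable_fun setT (noise : T -> mxT).
Proof.
have := measurable_noise_mx _ _ _ _ _ _ Z 0; rewrite (_ : (fun w => _) = noise)//.
by apply/funext => w; rewrite add0r.
Qed.


Lemma label_val_inj : injective (label_val R).
Proof.
exact: signr_inj.
Qed.

Lemma signal_rectangle_prob la S (F : 'I_n * 'I_p -> set R) :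
  (forall k, measurable (F k)) ->
  P (signal_event la S `&` [set w | forall k, F k (Z k.1 k.2 w)]) =
  (((1 / 2) ^+ n * support_weight R 'I_p eps S)%:E *
    P [set w | forall k, F k (Z k.1 k.2 w)])%E.
Proof.
move=> mF.
pose E (x : 'I_n + 'I_p + 'I_n * 'I_p) : set R := match x with
  | inl (inl i) => [set label_val R (la i)]
  | inl (inr j) => [set tau *+ (j \in S)]
  | inr k => F k
  end.
have mE x : measurable (E x) by case: x => [[i|j]|k] /=.
have famE w : (forall x, E x (arw_family l mu Z x w)) <->
    signal_event la S w /\ (forall k, F k (Z k.1 k.2 w)).
  split => [H|[[Hl Hm] HZ]].
    split; last by move=> k; have := H (inr k); case: k.
    split; first by move=> i; apply: label_val_inj; exact: (H (inl (inl i))).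
    by move=> j; exact: (H (inl (inr j))).
  case=> [[i|j]|[i j]] /=; first by rewrite Hl.
    by rewrite Hm.
  exact: (HZ (i, j)).
have indep := @arw_indep _ _ _ _ _ _ _ _ _ _ _ model [set: _]%SET E (fun x _ => mE x).
have nindep := noise_independent [set: _]%SET F (fun x _ => mF x).
have -> : [set w | forall k, F k (Z k.1 k.2 w)] =
    \bigcap_(k in [set` [set: 'I_n * 'I_p]%SET]) (Z k.1 k.2 @^-1` F k).
  apply/seteqP; split => w /= H k; first by move=> _; exact: H.
  by apply: H; rewrite /= inE.
rewrite nindep.
transitivity (P (\bigcap_(x in [set` [set: 'I_n + 'I_p + 'I_n * 'I_p]%SET])
    (arw_family l mu Z x @^-1` E x))).
  congr (P _); apply/seteqP; split => w /=.
    move=> [Hs HF] x _; apply: (famE w).2; split => // k.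
    by apply: HF; rewrite /= inE.
  move=> H; have [Hs HF] : signal_event la S w /\ (forall k, F k (Z k.1 k.2 w)).
    by apply/famE => x; apply: H; rewrite /= inE.
  by split => // k _; exact: HF.
rewrite indep (eq_bigl xpredT) => [|x]; last by rewrite inE.
rewrite [in RHS](eq_bigl xpredT) => [|x]; last by rewrite inE.
rewrite big_sumType/= big_sumType/=; congr (_ * _)%E; last first.
  by apply: eq_bigr => -[i j] _.
rewrite EFinM; congr (_ * _)%E.
  under eq_bigr => i _.
    rewrite (_ : _ @^-1` _ = [set w | l i w = la i]); last first.
      by apply/seteqP; split => w /= => [/label_val_inj|->].
    rewrite (label_law model); over.
  by rewrite prodEFin prodr_const card_ord.
rewrite /support_weight -prodEFin; apply: eq_bigr => j _.
by case: ifP => _; [exact: (mu_law_tau model)|exact: (mu_law_zero model)].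
Qed.

(** Both sides are finite measures in [E]: the law of the noise restricted to the signal event, and
    a multiple of the law of the noise. They agree on rectangles by [signal_rectangle_prob]. *)
Lemma signal_noise_law la S (E : set mxT) : measurable E ->
  P (signal_event la S `&` noise @^-1` E) =
  (((1 / 2) ^+ n * support_weight R 'I_p eps S)%:E * P (noise @^-1` E))%E.
Proof.
move=> mE; have mS := measurable_signal_event la S.
have c0 : 0 <= (1 / 2) ^+ n * support_weight R 'I_p eps S.
  by rewrite mulr_ge0 ?support_weight_ge0// exprn_ge0//; lra.
have mN := measurable_noise.
pose N : {mfun T >-> mxT} := HB.pack (noise : T -> mxT) (isMeasurableFun.Build _ _ _ _ _ mN).
rewrite setIC -[LHS]/(pushforward (mrestr P mS) N E).
rewrite -[RHS]/(mscale (NngNum c0) (distribution P N) E).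
apply: mx_measure_unique => //.
  move=> F mF.
  have preE : noise @^-1` [set M : 'M[R]_(n, p) | forall k, F k (M k.1 k.2)] =
      [set w | forall k, F k (Z k.1 k.2 w)].
    by apply/seteqP; split => w /= H k; have := H k; rewrite mxE.
  rewrite /= /mscale /= /pushforward /mrestr /= setIC preE.
  by rewrite signal_rectangle_prob// /distribution /pushforward -preE.
rewrite /= /pushforward /mrestr/= preimage_setT setTI.
by apply: le_lt_trans (probability_le1 _ mS) _; rewrite ltry.
Qed.

Variables (A : 'M[R]_n) (B : 'M[R]_p) (hatl : 'M[R]_(n, p) -> 'I_n -> bool).
Hypotheses (Aunit : A \in unitmx) (Bunit : B \in unitmx).
Hypothesis hatl_measurable : procedure_measurable hatl.

Definition whitened_mean (la : 'I_n -> bool) : 'cV[R]_n :=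
  tau *: (invmx A *m \col_i label_val R (la i)).

(** The decision is read as an event on the whitened matrix, where the noise has independent
    standard entries. *)
Definition decision_event (i : 'I_n) (b : bool) : set mxT :=
  [set Y : 'M[R]_(n, p) | hatl (A *m Y *m B) i = b].

Lemma measurable_mx_affine (C : 'M[R]_n) (D : 'M[R]_p) dX (X : measurableType dX)
    (f : X -> 'M[R]_(n, p)) :
  (forall i j, measurable_fun setT (fun x => f x i j)) ->
  measurable_fun setT (fun x => C *m f x *m D : mxT).
Proof.
move=> mf; apply: measurable_mxP => i j; under eq_fun do rewrite mxE.
apply: measurable_sum => k; apply: measurable_funM => //.
under eq_fun do rewrite mxE.
by apply: measurable_sum => k'; apply: measurable_funM.
Qed.

Lemma measurable_decision_event i b : measurable (decision_event i b).
Proof.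
have mf := @measurable_mx_affine A B _ mxT id (@measurable_coord R n p).
have := mf measurableT _ (hatl_measurable i b); by rewrite setTI.
Qed.

Lemma arw_data_on_signal la S w : signal_event la S w ->
  arw_data l mu Z A B w =
  A *m (support_mean R n p (invmx B) (whitened_mean la) S + noise w) *m B.
Proof.
move=> [lw mw]; rewrite mulmxDr mulmxDl; congr (_ + _).
have -> : \col_i label_val R (l i w) = \col_i label_val R (la i).
  by apply/colP => i; rewrite !mxE lw.
have -> : \row_j mu j w = tau *: (indicator_col R p S)^T.
  by apply/rowP => j; rewrite !mxE mw; case: (_ \in _); rewrite ?mulr1 ?mulr0.
rewrite /support_mean /whitened_mean trmx_mul trmxK.
rewrite -!scalemxAl -!scalemxAr -!scalemxAl; congr (_ *: _).
by rewrite !mulmxA mulmxV// mul1mx mulmxKV.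
Qed.

Lemma measurable_error i (s : bool -> bool) :
  measurable [set w | hatl (arw_data l mu Z A B w) i <> s (l i w)].
Proof.
have mX : measurable_fun setT (fun w => arw_data l mu Z A B w : mxT).
  apply: measurable_mxP => i' j.
  have -> : (fun w => arw_data l mu Z A B w i' j) =
      (fun w => label_val R (l i' w) * mu j w + (A *m noise w *m B) i' j).
    by apply/funext => w; rewrite /arw_data mxE; congr (_ + _); rewrite mxE big_ord1 !mxE.
  apply: measurable_funD.
    apply: measurable_funM => //.
    have -> : (fun w => label_val R (l i' w)) = (fun w => if l i' w then -1 else 1).
      by apply/funext => w; rewrite /label_val; case: (l i' w).
    by apply: measurable_fun_ifT.
  have mN : measurable_fun setT (fun w => A *m noise w *m B : mxT).
    apply: measurable_mx_affine => i'' j'; under eq_fun do rewrite mxE.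
    exact: measurable_funPT.
  exact: (measurableT_comp (measurable_coord R n p i' j) mN).
have -> : [set w | hatl (arw_data l mu Z A B w) i <> s (l i w)] =
    \bigcup_(b in [set: bool]) ((l i @^-1` [set b]) `&`
       ((fun w => arw_data l mu Z A B w : mxT) @^-1` [set M : mxT | hatl M i = ~~ s b])).
  apply/seteqP; split => w /=.
    by move=> H; exists (l i w) => //=; split => //; case: (hatl _ _) (s _) H => -[].
  by move=> [b _ [/= -> ->]]; case: (s b).
apply: fin_bigcup_measurable => // b _; apply: measurableI; first exact: measurable_funPTI.
rewrite -[X in measurable X]setTI; apply: mX => //; exact: hatl_measurable.
Qed.

Local Notation sp b i M := (shift_prob _ _ _ P _ _ Z (decision_event i b) M).

(** The error event is split according to labels and support. Values of [mu] other than 0 and [tau]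
    belong to no signal event, so the sum is compared with the error probability by inclusion, and
    this direction suffices for a lower bound. *)
Lemma error_prob_ge i (s : bool -> bool) :
  \sum_(la : {ffun 'I_n -> bool}) (1 / 2) ^+ n * \sum_(S : {set 'I_p})
    support_weight R 'I_p eps S *
    sp (~~ s (la i)) i (support_mean R n p (invmx B) (whitened_mean la) S) <=
  fine (P [set w | hatl (arw_data l mu Z A B w) i <> s (l i w)]).
Proof.
have mE := measurable_error i s.
rewrite -lee_fin fineK ?fin_num_measure//.
pose D (x : {ffun 'I_n -> bool} * {set 'I_p}) := signal_event x.1 x.2 `&`
  [set w | decision_event i (~~ s (x.1 i))
     (support_mean R n p (invmx B) (whitened_mean x.1) x.2 + noise w)].
have mD x : measurable (D x).
  apply: measurableI; first exact: measurable_signal_event.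
  by apply: measurable_shift_event; exact: measurable_decision_event.
have tD : trivIset setT D.
  apply/trivIsetP => -[la S] [la' S'] _ _ neq; apply/seteqP; split => // w.
  (* The support can be read off [mu] because [tau] is nonzero. *)
  move=> [[[lw mw] _] [[lw' mw'] _]]; move: neq => /=; apply/negP; rewrite negbK.
  apply/eqP; congr (_, _); first by apply/ffunP => k; rewrite -lw -lw'.
  apply/setP => j; have := mw j; rewrite mw'.
  case: (j \in S) (j \in S') => -[] //=; rewrite !mulr1n !mulr0n => /eqP.
    by rewrite eq_sym (negbTE tau_neq0).
  by rewrite (negbTE tau_neq0).
apply: (@le_trans _ _ (P (\bigcup_(x in setT) D x))); last first.
  apply: le_measure; rewrite ?inE//; first exact: fin_bigcup_measurable.
  move=> w [[la S] _ [Hs]]; rewrite /= => HE.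
  rewrite (arw_data_on_signal _ _ _ Hs) HE.
  by have [-> _] := Hs; case: (s _).
rewrite measure_fin_bigcup//; last exact: finite_finset.
rewrite (fsbigE (index_enum _)) ?index_enum_uniq//; last by move=> x _; rewrite mem_index_enum.
rewrite (eq_bigl xpredT) => [|x]; last by rewrite in_setT.
under [X in (X%:E <= _)%E]eq_bigr do rewrite big_distrr/=.
rewrite pair_bigA -sumEFin/= le_eqVlt; apply/orP; left; apply/eqP.
apply: eq_bigr => -[la S] _ /=.
pose M := support_mean R n p (invmx B) (whitened_mean la) S.
have mEM : measurable ([set N : mxT | decision_event i (~~ s (la i)) (M + N)] : set mxT).
  rewrite -[X in measurable X]setTI.
  have : measurable_fun setT (fun N : mxT => M + N : mxT).
    apply: measurable_mxP => i' j; under eq_fun do rewrite mxE.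
    by apply: measurable_funD => //; exact: measurable_coord.
  by apply => //; exact: measurable_decision_event.
rewrite /D/= (signal_noise_law la S _ mEM) mulrA EFinM; congr (_ * _)%E.
by rewrite fineK ?fin_num_measure//; apply: measurable_shift_event; exact: measurable_decision_event.
Qed.

Lemma decision_prob_false i M : sp false i M = 1 - sp true i M.
Proof.
have mE := measurable_shift_event d T R P n p Z _ M (measurable_decision_event i true).
rewrite /shift_prob.
have -> : [set w | decision_event i false (M + noise w)] =
    ~` [set w | decision_event i true (M + noise w)].
  by apply/seteqP; split => w; rewrite /decision_event/=; case: (hatl _ _).
by rewrite probability_setC// fineB// fin_num_measure.
Qed.

Lemma shift_regular_decision i b : shift_regular R n p (fun M => sp b i M).
Proof.
split=> [M|J c D M]; last first.
  apply: shift_prob_combination; [exact: noise_law model|exact: noise_independent|].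
  exact: measurable_decision_event.
have mE := measurable_shift_event d T R P n p Z _ M (measurable_decision_event i b).
by rewrite -!lee_fin fineK ?fin_num_measure// measure_ge0 probability_le1.
Qed.

Definition set_label (la : {ffun 'I_n -> bool}) (i : 'I_n) (b : bool) :=
  [ffun k => if k == i then b else la k].

(** Flipping the label at [i] is an involution; the sum is added to its image under the flip. *)
Lemma sum_set_label (f : {ffun 'I_n -> bool} -> R) i :
  2 * \sum_la f la = \sum_la (f (set_label la i true) + f (set_label la i false)).
Proof.
pose flip la := set_label la i (~~ la i).
have flipK : involutive flip.
  move=> la; apply/ffunP => k; rewrite !ffunE eqxx negbK.
  by case: eqP => // ->.
rewrite mulr_natl mulr2n {2}(reindex_inj (inv_inj flipK)) -big_split/=.
apply: eq_bigr => la _.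
have la_id : la = set_label la i (la i).
  by apply/ffunP => k; rewrite ffunE; case: eqP => // ->.
by rewrite {1}la_id /flip; case: (la i); rewrite // addrC.
Qed.

(** A two-point argument: with the other labels fixed, the error probabilities for the two values of
    the label at [i] add up to [1 - X] or [1 + X], according to which bijection [s] is, where [X] is
    the difference bounded by [de]. *)
Lemma error_prob_half i (s : bool -> bool) (de : R) : s true != s false ->
  (forall la, `|\sum_S support_weight R 'I_p eps S *
     (sp true i (support_mean R n p (invmx B) (whitened_mean (set_label la i true)) S) -
      sp true i (support_mean R n p (invmx B) (whitened_mean (set_label la i false)) S))|
     <= de) ->
  (1 - de) / 2 <= fine (P [set w | hatl (arw_data l mu Z A B w) i <> s (l i w)]).
Proof.
move=> sneq Hde; apply: le_trans (error_prob_ge i s).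
set f := fun la : {ffun 'I_n -> bool} => \sum_(S : {set 'I_p}) support_weight R 'I_p eps S *
    sp (~~ s (la i)) i (support_mean R n p (invmx B) (whitened_mean la) S).
rewrite -big_distrr/= -/f.
suff : (1 - de) * 2 ^+ n <= 2 * \sum_la f la.
  have : 0 < 2 ^+ n :> R by rewrite exprn_gt0.
  rewrite -[(1 / 2) ^+ n]/(_) div1r exprVn => n0 h.
  by rewrite ler_pdivrMr// [_^-1 * _]mulrC mulrAC ler_pdivlMr// [leRHS]mulrC.
rewrite (sum_set_label f i).
apply: (@le_trans _ _ (\sum_(la : {ffun 'I_n -> bool}) (1 - de))).
  by rewrite sumr_const card_ffun card_bool card_ord -[leRHS]mulr_natr natrX.
apply: ler_sum => la _; rewrite /f !ffunE eqxx -big_split/=.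
have := Hde la; rewrite ler_norml => /andP[h1 h2].
have W1 := sum_support_weight R 'I_p eps.
move: sneq h1 h2; set a1 := whitened_mean _; set a0 := whitened_mean _.
set X := \sum_S _ => sneq h1 h2.
have [->|->] : \sum_(S : {set 'I_p}) (support_weight R 'I_p eps S *
    sp (~~ s true) i (support_mean R n p (invmx B) a1 S) +
    support_weight R 'I_p eps S * sp (~~ s false) i (support_mean R n p (invmx B) a0 S)) = 1 + X \/
  \sum_(S : {set 'I_p}) (support_weight R 'I_p eps S *
    sp (~~ s true) i (support_mean R n p (invmx B) a1 S) +
    support_weight R 'I_p eps S * sp (~~ s false) i (support_mean R n p (invmx B) a0 S)) = 1 - X.
- case: (s true) (s false) sneq => -[]//= _; [right|left].
    rewrite -W1 /X -sumrB; apply: eq_bigr => S _; rewrite decision_prob_false; ring.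
  rewrite -W1 /X -big_split; apply: eq_bigr => S _; rewrite decision_prob_false /=; ring.
- lra.
- lra.
Qed.
End model.

(** * Rates *)

Lemma limn_einf_ge (R : realType) (u : (\bar R)^nat) (x : R) :
  (forall e : R, 0 < e -> \forall p \near \oo, ((x - e)%:E <= u p)%E) ->
  (x%:E <= limn_einf u)%E.
Proof.
move=> Hu; apply/lee_subgt0Pr => e e0; rewrite limn_einf_lim -EFinB.
apply: lime_ge; first exact: is_cvg_einfs.
have [N _ HN] := Hu e e0; exists N => // m Nm.
apply: le_ereal_inf_tmp => _ [k /= mk <-]; apply: HN.
exact: leq_trans mk.
Qed.

Section rates.
Variables (R : realType) (LA LB : nat -> R).
Hypotheses (hLA : multi_log LA) (hLB : multi_log LB).

(** The power is shared equally, [ga / 2] for each of the two multi-logarithmic factors. *)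
Lemma near_rate_le (ga e : R) : 0 < ga -> 0 < e ->
  \forall p \near \oo, LA p * LB p * p%:R `^ (- ga) <= e.
Proof.
move=> ga0 e0; have ga2 : 0 < ga / 2 by rewrite divr_gt0.
have [_ /(_ _ ga2)[LA0 _]] := hLA; have [_ /(_ _ ga2)[LB0 _]] := hLB.
have : ((fun p => LA p * p%:R `^ (- (ga / 2))) \* (fun p => LB p * p%:R `^ (- (ga / 2))))
    @ \oo --> (0 : R) by rewrite -[0](mul0r (0 : R)); exact: cvgM.
move=> /cvgrPdist_le /(_ e e0).
apply: filterS => p; rewrite sub0r normrN => /(le_trans (ler_norm _)).
rewrite /= mulrACA (_ : _ `^ _ * _ `^ _ = p%:R `^ (- ga))//.
have [->|p0] := eqVneq p 0%N.
  by rewrite !powR0 ?mul0r// oppr_eq0 gt_eqF.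
rewrite -powRD; last by rewrite pnatr_eq0 p0 implybT.
by congr (_ `^ _); field.
Qed.

Lemma near_powR_le_half (be : R) : 0 < be ->
  \forall p \near \oo, p%:R `^ (- be) <= 1 / 2 :> R.
Proof.
move=> be0; have be2 : 0 < be / 2 by rewrite divr_gt0.
have [LA0 /(_ _ be2)[/cvgrPdist_le /(_ 1 ltr01) le1 /cvgryPge /(_ 2) ge2]] := hLA.
near=> p.
have p0 : (0 < p)%N by near: p; exact: nbhs_infty_gt.
have h1 : `|0 - LA p * p%:R `^ (- (be / 2))| <= 1 by near: p.
have h2 : 2 <= LA p * p%:R `^ (be / 2) by near: p.
have q0 : 0 < p%:R `^ (be / 2) :> R by rewrite powR_gt0// ltr0n.
move: h1; rewrite sub0r normrN => /(le_trans (ler_norm _)).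
have -> : - be = - (be / 2) + - (be / 2) by field.
rewrite powRD ?pnatr_eq0 -?lt0n ?p0 ?implybT// powRN.
move: q0 h2; set q := _ `^ _; set a := LA p => q0 h2 h1.
have a0 : 0 < a by exact: LA0.
rewrite -invfM -[_^-1]mul1r ler_pdivrMr ?mulr_gt0//.
move: h1; rewrite ler_pdivrMr// mul1r => h1; nra.
Unshelve. all: by end_near. Qed.
End rates.

(** * Lower bounds on the clustering error for fixed dimensions *)

Section model_bounds.
Variables (R : realType) (d : measure_display) (T : measurableType d).
Variables (P : probability T R) (n p : nat) (eps tau : R).
Variables (l : 'I_n -> {RV P >-> bool}) (mu : 'I_p -> {RV P >-> R}).
Variable Z : 'I_n -> 'I_p -> {RV P >-> R}.
Hypothesis model : arw_model eps tau l mu Z.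
Hypotheses (eps01 : 0 <= eps < 1) (tau_gt0 : 0 < tau).
Variables (A : 'M[R]_n) (B : 'M[R]_p) (hatl : 'M[R]_(n, p) -> 'I_n -> bool).
Hypotheses (Aunit : A \in unitmx) (Bunit : B \in unitmx).
Hypothesis hatl_measurable : procedure_measurable hatl.
Variables (LA LB : R).
Hypothesis invA_le : spectral_norm (invmx A) <= LA.
Hypothesis invB_le : spectral_norm (invmx B) <= LB.
Local Notation wmean la := (whitened_mean R n tau A la).
Local Notation cd := (cdot R _).

Lemma cdot_whitened (x : 'cV[R]_n) :
  cd (tau *: (invmx A *m x)) (tau *: (invmx A *m x)) <= tau ^+ 2 * LA ^+ 2 * cd x x.
Proof.
rewrite cdotZl cdotC cdotZl mulrA -expr2 -mulrA ler_wpM2l ?sqr_ge0//.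
exact: cdot_mulmx_le.
Qed.

Lemma cdot_whitened_mean (la : 'I_n -> bool) :
  cd (wmean la) (wmean la) <= tau ^+ 2 * LA ^+ 2 * n%:R.
Proof.
apply: le_trans (cdot_whitened _) _; rewrite le_eqVlt; apply/orP; left; apply/eqP.
congr (_ * _); rewrite /cdot -[n in RHS]card_ord -sum1_card natr_sum.
by apply: eq_bigr => i _; rewrite !mxE -expr2 sqrr_sign.
Qed.

Lemma cdot_whitened_flip la i :
  cd (wmean (set_label n la i true) - wmean (set_label n la i false))
     (wmean (set_label n la i true) - wmean (set_label n la i false)) <=
  tau ^+ 2 * LA ^+ 2 * 4.
Proof.
rewrite /whitened_mean -scalerBr -mulmxBr; apply: le_trans (cdot_whitened _) _.
rewrite le_eqVlt; apply/orP; left; apply/eqP; congr (_ * _).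
rewrite /cdot (bigD1 i)//= !mxE !ffunE eqxx /label_val expr1 expr0 big1 ?addr0.
  by ring.
by move=> j /negbTE ji; rewrite !mxE !ffunE ji subrr mul0r.
Qed.

Let eps01' : 0 <= eps <= 1. Proof. by move: eps01 => /andP[-> /ltW ->]. Qed.
Let tau_neq0 : tau != 0. Proof. exact: lt0r_neq0. Qed.
Let LA_ge0 : 0 <= LA. Proof. exact: le_trans (spectral_norm_ge0 _ _ _ _) invA_le. Qed.
Let LB_ge0 : 0 <= LB. Proof. exact: le_trans (spectral_norm_ge0 _ _ _ _) invB_le. Qed.

Lemma hamm_ge (de : R) : (0 < n)%N ->
  (forall i (s : bool -> bool), s true != s false ->
    (1 - de) / 2 <= fine (P [set w | hatl (arw_data l mu Z A B w) i <> s (l i w)])) ->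
  (((1 - de) / 2)%:E <= hamm l (arw_data l mu Z A B) hatl)%E.
Proof.
move=> n0 Hde; have nR : 0 < n%:R :> R by rewrite ltr0n.
rewrite /hamm; set I := ereal_inf _.
suff : ((n%:R * ((1 - de) / 2))%:E <= I)%E.
  move=> /(lee_wpmul2l (x := (n%:R^-1)%:E)); rewrite lee_fin invr_ge0 ler0n -EFinM mulKf ?gt_eqF//.
  by apply.
apply: le_ereal_inf_tmp => _ [s _ <-].
rewrite mulr_natl -[n in X in (X <= _)%E]card_ord -sumr_const -sumEFin.
apply: lee_sum => i _; have mE := measurable_error R d T P n p l mu Z A B hatl hatl_measurable i s.
rewrite -[leRHS]fineK ?fin_num_measure// lee_fin; apply: Hde.
by rewrite (inj_eq perm_inj).
Qed.

Lemma hamm_ge_dense : (0 < n)%N ->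
  tau ^+ 2 * LA ^+ 2 * n%:R * LB ^+ 2 <= 1 / 4 ->
  (((1 - eps / (1 - eps) * (4 * tau * LA * Num.sqrt p%:R * LB)) / 2)%:E <=
   hamm l (arw_data l mu Z A B) hatl)%E.
Proof.
move=> n0 small; apply: hamm_ge => // i s sneq.
apply: (@error_prob_half R d T P n p eps tau l mu Z model) => // la.
have reg : shift_regular R n p
    (fun M => shift_prob d T R P n p Z (decision_event R n p A B hatl i true) M).
  by apply: shift_regular_decision model _ _ _ _ _ _.
apply: le_trans (@dense_bound R n p (invmx B) LB invB_le _ reg eps eps01
  (fun b => wmean (set_label n la i b)) (tau ^+ 2 * LA ^+ 2 * n%:R)
  (fun b => cdot_whitened_mean _) small) _.
have r0 : 0 <= eps / (1 - eps) by case/andP: eps01 => ? ?; rewrite divr_ge0// subr_ge0 ltW.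
apply: ler_wpM2l => //; apply: ler_wpM2r => //.
rewrite sqrtrM ?cdot_ge0// mulrA; apply: ler_wpM2r => //.
apply: (@le_trans _ _ (2 * Num.sqrt (tau ^+ 2 * LA ^+ 2 * 4))).
  by rewrite ler_wpM2l// ler_wsqrtr// cdot_whitened_flip.
rewrite (_ : tau ^+ 2 * LA ^+ 2 * 4 = (2 * tau * LA) ^+ 2); last by ring.
have tL0 : 0 <= 2 * tau * LA by rewrite !mulr_ge0// ltW.
by rewrite sqrtr_sqr ger0_norm// !mulrA -natrM.
Qed.

Lemma hamm_ge_sparse (c : R) : (0 < n)%N -> 0 < c ->
  (((1 - (c / 2 + 4 * (tau ^+ 2 * LA ^+ 2 * LB ^+ 2 * (eps * p%:R)) / c)) / 2)%:E <=
   hamm l (arw_data l mu Z A B) hatl)%E.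
Proof.
move=> n0 c0; apply: hamm_ge => // i s sneq.
apply: (@error_prob_half R d T P n p eps tau l mu Z model) => // la.
have reg : shift_regular R n p
    (fun M => shift_prob d T R P n p Z (decision_event R n p A B hatl i true) M).
  by apply: shift_regular_decision model _ _ _ _ _ _.
apply: le_trans (@sparse_bound R n p (invmx B) LB invB_le _ reg eps eps01 _ _ c c0) _.
rewrite lerD2l; apply: ler_wpM2r; first by rewrite invr_ge0 ltW.
have e0 : 0 <= eps * p%:R by case/andP: eps01 => ? _; rewrite mulr_ge0.
have -> : 4 * (tau ^+ 2 * LA ^+ 2 * LB ^+ 2 * (eps * p%:R)) =
  tau ^+ 2 * LA ^+ 2 * 4 * LB ^+ 2 * (eps * p%:R) by ring.
by rewrite ler_wpM2r// ler_wpM2r ?sqr_ge0// cdot_whitened_flip.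
Qed.
End model_bounds.

Theorem theorem1p5 (R : realType) (theta beta alpha : R)
    (htheta : 0 < theta < 1) (hbeta : 0 < beta < 1) (halpha : 0 < alpha)
    (heta : eta_clu theta beta < alpha)
    (d : nat -> measure_display) (T : forall p : nat, measurableType (d p))
    (P : forall p : nat, probability (T p) R)
    (l : forall p : nat, 'I_(arw_n theta p) -> {RV (P p) >-> bool})
    (mu : forall p : nat, 'I_p -> {RV (P p) >-> R})
    (Z : forall p : nat, 'I_(arw_n theta p) -> 'I_p -> {RV (P p) >-> R})
    (hmodel : forall p : nat,
      arw_model (arw_eps beta p) (arw_tau alpha p) (l p) (mu p) (Z p))
    (LA LB : nat -> R) (hLA : multi_log LA) (hLB : multi_log LB)
    (A : forall p : nat, 'M[R]_(arw_n theta p)) (B : forall p : nat, 'M[R]_p)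
    (hAunit : forall p : nat, A p \in unitmx)
    (hA : forall p : nat,
      Num.max (spectral_norm (A p)) (spectral_norm (invmx (A p))) <= LA p)
    (hBunit : forall p : nat, B p \in unitmx)
    (hB : forall p : nat,
      Num.max (spectral_norm (B p)) (spectral_norm (invmx (B p))) <= LB p)
    (hatl : forall p : nat,
      'M[R]_(arw_n theta p, p) -> 'I_(arw_n theta p) -> bool)
    (hhatl : forall p : nat, procedure_measurable (hatl p)) :
  ((1 / 2)%:E <=
   limn_einf (fun p : nat =>
     hamm (l p) (arw_data (l p) (mu p) (Z p) (A p) (B p)) (hatl p)))%E.
Proof.
have [th0 th1] := andP htheta; have [be0 be1] := andP hbeta.
have LA0 p : 0 < LA p by case: hLA.
have LB0 p : 0 < LB p by case: hLB.
have hiA p : spectral_norm (invmx (A p)) <= LA p.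
  by apply: le_trans (hA p); rewrite le_max lexx orbT.
have hiB p : spectral_norm (invmx (B p)) <= LB p.
  by apply: le_trans (hB p); rewrite le_max lexx orbT.
have tau0 p : (0 < p)%N -> 0 < arw_tau alpha p by move=> p0; rewrite powR_gt0 ?ltr0n.
have n_gt0 p : (0 < p)%N -> (0 < arw_n theta p)%N.
  move=> p0; rewrite truncn_gt0 -[leLHS](powRr0 p%:R).
  by rewrite ler_powR ?ler1n// ltW.
have n_le p : (arw_n theta p)%:R <= p%:R `^ theta :> R.
  by rewrite truncn_le powR_ge0.
have pD p (x y : R) : (0 < p)%N -> p%:R `^ (x + y) = p%:R `^ x * p%:R `^ y :> R.
  by move=> p0; rewrite powRD// pnatr_eq0 -lt0n p0 implybT.
have eps_half := near_powR_le_half _ _ hLA _ be0.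
have eps_ge0 p : 0 <= arw_eps beta p by exact: powR_ge0.
apply: limn_einf_ge => e e0.
(* On its first two branches [eta_clu] is the maximum of [theta / 2] and [(1 - 2 * beta) / 2]. *)
have [dense|sparse] : (theta / 2 < alpha /\ (1 - 2 * beta) / 2 < alpha) \/
    (1 - beta) / 2 < alpha.
  move: heta; rewrite /eta_clu; case: ifPn => [h1|h1]; first by left; split; lra.
  by case: ifPn => h2 h3; [left; split; move: h1; rewrite -ltNge => h1; lra|right].
- pose ga1 := alpha + beta - 1 / 2; pose ga2 := alpha - theta / 2.
  have ga10 : 0 < ga1 by rewrite /ga1; lra.
  have ga20 : 0 < ga2 by rewrite /ga2; lra.
  (* The loss is at most 8 times this rate, since [eps / (1 - eps) <= 2 * eps]; after halving,
     [e / 4] leaves exactly [e]. The threshold 1/2 below squares to the 1/4 of the smallness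
     condition. *)
  have near1 := near_rate_le _ _ _ hLA hLB _ (e / 4) ga10 (divr_gt0 e0 _).
  have near2 := near_rate_le _ _ _ hLA hLB _ (1 / 2) ga20 _.
  near=> p.
  have p0 : (0 < p)%N by near: p; exact: nbhs_infty_gt.
  have he : arw_eps beta p <= 1 / 2 by near: p; exact: eps_half.
  have h1 : LA p * LB p * p%:R `^ (- ga1) <= e / 4.
    by near: p; apply: near1.
  have h2 : LA p * LB p * p%:R `^ (- ga2) <= 1 / 2.
    by near: p; apply: near2; lra.
  have eps1 : 0 <= arw_eps beta p < 1 by rewrite eps_ge0; lra.
  have t0 := tau0 p p0; have a0 := LA0 p; have b0 := LB0 p.
  have sqrtp : Num.sqrt p%:R = p%:R `^ (1 / 2) :> R by rewrite div1r powR12_sqrt.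
  apply: le_trans (hamm_ge_dense _ _ _ _ _ _ _ _ _ _ _ (hmodel p) eps1 t0 _ _ _
    (hAunit p) (hBunit p) (hhatl p) _ _ (hiA p) (hiB p) (n_gt0 p p0) _).
    rewrite lee_fin sqrtp.
    have ga1E : p%:R `^ (- ga1) =
        arw_tau alpha p * arw_eps beta p * p%:R `^ (1 / 2).
      by rewrite /arw_tau /arw_eps -!pD//; congr (_ `^ _); rewrite /ga1; ring.
    rewrite ga1E in h1.
    have q0 : 0 <= p%:R `^ (1 / 2) :> R by exact: powR_ge0.
    have r2 : arw_eps beta p / (1 - arw_eps beta p) <= 2 * arw_eps beta p.
      by rewrite ler_pdivrMr; [have := eps_ge0 p; nra|lra].
    have : arw_eps beta p / (1 - arw_eps beta p) *
        (4 * arw_tau alpha p * LA p * p%:R `^ (1 / 2) * LB p) <=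
        2 * arw_eps beta p * (4 * arw_tau alpha p * LA p * p%:R `^ (1 / 2) * LB p).
      by apply: ler_wpM2r => //; rewrite !mulr_ge0// ltW.
    lra.
  apply: (@le_trans _ _ ((LA p * LB p * p%:R `^ (- ga2)) ^+ 2)).
    have -> : p%:R `^ (- ga2) = arw_tau alpha p * p%:R `^ (theta / 2).
      by rewrite /arw_tau -pD//; congr (_ `^ _); rewrite /ga2; ring.
    have -> : (LA p * LB p * (arw_tau alpha p * p%:R `^ (theta / 2))) ^+ 2 =
        arw_tau alpha p ^+ 2 * LA p ^+ 2 * p%:R `^ theta * LB p ^+ 2.
      rewrite (_ : p%:R `^ theta = p%:R `^ (theta / 2) ^+ 2); first by ring.
      by rewrite expr2 -pD//; congr (_ `^ _); field.
    by rewrite ler_wpM2r ?sqr_ge0// ler_wpM2l// mulr_ge0 ?sqr_ge0.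
  have y0 : 0 <= LA p * LB p * p%:R `^ (- ga2) by rewrite !mulr_ge0 ?powR_ge0// ltW.
  nra.
(* The exponent of the square root of [tau ^+ 2 * (eps * p)]. *)
- pose ga := alpha + (beta - 1) / 2.
  have ga0 : 0 < ga by rewrite /ga; lra.
  have near1 := near_rate_le _ _ _ hLA hLB _ (e / 4) ga0 (divr_gt0 e0 _).
  near=> p.
  have p0 : (0 < p)%N by near: p; exact: nbhs_infty_gt.
  have he : arw_eps beta p <= 1 / 2 by near: p; exact: eps_half.
  have h1 : LA p * LB p * p%:R `^ (- ga) <= e / 4.
    by near: p; apply: near1.
  have eps1 : 0 <= arw_eps beta p < 1 by rewrite eps_ge0; lra.
  have t0 := tau0 p p0; have a0 := LA0 p; have b0 := LB0 p.
  (* The free constant is taken to be [e]: the loss before halving is then at most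
     [e / 2 + e / 4]. *)
  apply: le_trans (hamm_ge_sparse _ _ _ _ _ _ _ _ _ _ _ (hmodel p) eps1 t0 _ _ _
    (hAunit p) (hBunit p) (hhatl p) _ _ (hiA p) (hiB p) e (n_gt0 p p0) e0).
  rewrite lee_fin.
  have -> : arw_tau alpha p ^+ 2 * LA p ^+ 2 * LB p ^+ 2 * (arw_eps beta p * p%:R) =
      (LA p * LB p * p%:R `^ (- ga)) ^+ 2.
    rewrite !exprMn (_ : p%:R `^ (- ga) ^+ 2 = arw_tau alpha p ^+ 2 * (arw_eps beta p * p%:R)).
      by ring.
    rewrite /arw_tau /arw_eps -[X in _ * (_ * X)](powRr1 (ler0n R p)) !expr2 -!pD//.
    by congr (_ `^ _); rewrite /ga; field.
  have y0 : 0 <= LA p * LB p * p%:R `^ (- ga) by rewrite !mulr_ge0 ?powR_ge0// ltW.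
  set z := LA p * _ * _ in y0 h1 *.
  have : 4 * z ^+ 2 / e <= e / 4 by rewrite ler_pdivrMr//; nra.
  lra.
Unshelve. all: by end_near.
Qed.
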